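(* Let $A$ be the generator of a bounded $C_0$-semigroup $(e^{At})_{t\ge0}$ on a Hilbert space $H$. Suppose there exist $\beta>1$, $M>0$ and $t_0>1$ such that \[ \big\|e^{At}(I-A)^{-1}\big\|\le\frac{M}{(\log t)^{\beta}}\qquad\text{for all }t\ge t_0 . \] Then \[ \sup_{t\ge0}\big\|e^{A^{-1}t}A^{-1}\big\|<\infty . \] In particular, this holds whenever $A$ generates a polynomially stable $C_0$-semigroup on $H$ (with any parameter $\beta>0$).
   Context: Under the stated decay hypothesis it is known that $i\mathbb{R}\cap\sigma(A)=\emptyset$; in particular $A^{-1}\in\mathcal{L}(H)$ and $e^{A^{-1}t}$ is the exponential of the bounded operator $tA^{-1}$. A $C_0$-semigroup $(e^{At})_{t\ge0}$ on a Hilbert space is called polynomially stable with parameter $\beta>0$ if it is bounded and there exist $M,t_0>0$ with $\|e^{At}(I-A)^{-1}\|\le M t^{-1/\beta}$ for all $t\ge t_0$. *)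

(* Defs.v *)
From HB Require Import structures.
From mathcomp Require Import all_boot all_order all_algebra.
From mathcomp Require Import all_classical all_reals all_analysis.
From mathcomp.real_closed Require Import complex.
Import Order.TTheory GRing.Theory Num.Theory.
Import numFieldNormedType.Exports.

Set Implicit Arguments.
Unset Strict Implicit.
Unset Printing Implicit Defensive.

Local Open Scope classical_set_scope.
Local Open Scope ring_scope.
Local Open Scope complex_scope.

(* Complex Hilbert spaces.  The carrier is a complete normed space over the *)
(* complex numbers C = R[i] (norms take values in R[i], as for any          *)
(* normedModType over R[i]); the norm is induced by an inner product which  *)
(* is linear in the first argument and conjugate-symmetric.                 *)
Definition is_inner_product (R : realType) (V : completeNormedModType R[i])
    (inner : V -> V -> R[i]) : Prop :=
  [/\ (forall (a : R[i]) (x y z : V), inner (a *: x + y) z = a * inner x z + inner y z),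
      (forall x y : V, inner y x = conjc (inner x y)) &
      (forall x : V, `|x| ^+ 2 = inner x x)].

Definition bounded_linear (R : realType) (V : completeNormedModType R[i])
    (B : V -> V) : Prop :=
  (forall (a : R[i]) (x y : V), B (a *: x + y) = a *: B x + B y) /\
  exists c : R, forall x : V, `|B x| <= c%:C * `|x|.

Definition C0_semigroup (R : realType) (V : completeNormedModType R[i])
    (T : R -> V -> V) : Prop :=
  [/\ (forall t, 0 <= t -> bounded_linear (T t)),
      (forall x, T 0 x = x),
      (forall s t x, 0 <= s -> 0 <= t -> T (s + t) x = T s (T t x)) &
      (forall x, T t x @[t --> 0^'+] --> x)].

Definition bounded_semigroup (R : realType) (V : completeNormedModType R[i])
    (T : R -> V -> V) : Prop :=
  exists K : R, forall t x, 0 <= t -> `|T t x| <= K%:C * `|x|.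

Definition generator (R : realType) (V : completeNormedModType R[i])
    (T : R -> V -> V) (D : set V) (A : V -> V) : Prop :=
  forall x : V,
    (D x <-> cvg ((h^-1)%:C *: (T h x - x) @[h --> 0^'+])) /\
    (D x -> (h^-1)%:C *: (T h x - x) @[h --> 0^'+] --> A x).

Definition op_inv (R : realType) (V : completeNormedModType R[i])
    (D : set V) (S : V -> V) (y : V) : V :=
  xget 0 [set x | D x /\ S x = y].

Definition res1 (R : realType) (V : completeNormedModType R[i])
    (D : set V) (A : V -> V) : V -> V :=
  op_inv D (fun x => x - A x).

Definition op_exp (R : realType) (V : completeNormedModType R[i])
    (B : V -> V) (t : R) (x : V) : V :=
  lim ((fun n : nat => \sum_(k < n) ((t ^+ k / (k`!)%:R)%:C) *: iter k B x) @ \oo).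

Definition polynomially_stable (R : realType) (V : completeNormedModType R[i])
    (T : R -> V -> V) (D : set V) (A : V -> V) (beta : R) : Prop :=
  bounded_semigroup T /\
  exists M t0 : R, [/\ 0 < M, 0 < t0 &
    forall t x, t0 <= t ->
      `|T t (res1 D A x)| <= (M * t `^ (- beta^-1))%:C * `|x|].

(* Main.v *)
Require Import Defs.
From HB Require Import structures.
From mathcomp Require Import all_boot all_order all_algebra.
From mathcomp Require Import all_classical all_reals all_analysis.
From mathcomp.real_closed Require Import complex.
From mathcomp Require Import ring lra.
Import Order.TTheory GRing.Theory Num.Theory.
Import numFieldNormedType.Exports.

(* Write [B_r = (A - r)^-1] and let [S_r] be its exponential, so that [S_0 t A^-1]
   is the operator to bound.  The form [F_r x = int_0^oo exp(-2 r s) |T s x|^2 ds]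
   satisfies [2 Re F_r(x, B_r x) = - |B_r x|^2], whence
   [int_0^oo |B_r (S_r t x)|^2 dt <= F_r x <= K^2 / (2 r) |x|^2]; the same holds for
   the adjoints.  Since [B_r - B_r' = (r - r') B_r B_r'], Duhamel's formula and
   Cauchy-Schwarz give [|S_r t x - S_r' t x| <= C |r - r'| sqrt (F_r x / r')].
   - Along [r = 16^j] from [1] up to [t] this yields [|S_1 t| = O(1 + log t)];
     with [t B_1^2 S_1(t) = O(1)] and the resolvent identity, [S_1(t) B_1] is
     bounded.
   - Along [r = 16^-k] the decay of [T s A^-1] gives [r F_r (A^-1 x) = O(k^(-2 beta))],
     so the increments of [S_r t (A^-1 x)] are [O(k^-beta)], summable as [beta > 1].
   That [A] is invertible follows from [T t x - x = int_0^t T s A x ds]: as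
   [T t (1 - A)^-1] tends to [0], it gives [|x| <= c |A x|].
   To avoid vector-valued integrals, [A] is replaced by the bounded operator
   [(T h - 1) / h] and exponentials by Euler products [(1 + k B)^n]; all bounds
   are uniform in [h] and [n]. *)

Set Implicit Arguments.
Unset Strict Implicit.
Unset Printing Implicit Defensive.
Local Open Scope ring_scope.

(** * Real inner product spaces *)

(** One change of shift is scale invariant: between [r] and [r / 16] the squared increment is at
    most a constant times [r * F_r x], which boundedness of [T] alone only makes O(1). Each rung
    then costs a constant. This is harmless for the finitely many rungs above shift [1], but it is
    the obstacle on the way down to shift [0]. Decay enters by cutting time at [4 ^ k], the square
    root of [1 / r = 16 ^ k]: earlier times contribute O([4 ^ k]) to [F_r], negligible against
    [16 ^ k], and later times carry the rate at [4 ^ k]. Since [ln (4 ^ k)] is proportional to [k],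
    the power [beta] of a logarithm becomes a power of the rung number. The difference quotients
    converge only strongly, so the parameters are chosen in a strict order: for given [t] and
    vector, first a last shift, then the number of Euler factors, then [h], small on the finitely
    many points of the Euler orbit. Complex scalars matter only through the real part of the inner
    product, which induces the same norm; hence the estimates are proved in real inner product
    spaces. *)

Definition real_inner (R : realType) (V : lmodType R) (sp : V -> V -> R) :=
  [/\ (forall a x y z, sp (a *: x + y) z = a * sp x z + sp y z),
      (forall x y, sp x y = sp y x), (forall x, 0 <= sp x x) &
      (forall x, sp x x = 0 -> x = 0)].

Definition hnorm (R : realType) (V : lmodType R) (sp : V -> V -> R) x :=
  Num.sqrt (sp x x).

(** Stated with sequences and [hnorm], so that a bare real vector space can be the carrier, with no
    topology attached to it. *)
Definition complete_inner (R : realType) (V : lmodType R) (sp : V -> V -> R) :=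
  forall u : nat -> V,
    (forall e, 0 < e -> exists N, forall m n, (N <= m)%N -> (N <= n)%N ->
      hnorm sp (u m - u n) <= e) ->
    exists l, forall e, 0 < e -> exists N, forall n, (N <= n)%N ->
      hnorm sp (u n - l) <= e.

Section LinearMaps.
Variables (R : realType) (V W : lmodType R) (f : V -> W).
Hypothesis lf : linear f.

Lemma mapD x y : f (x + y) = f x + f y.
Proof. by rewrite -[x in LHS]scale1r lf scale1r. Qed.

Lemma map0 : f 0 = 0.
Proof. by have := mapD 0 0; rewrite addr0 => /esym/eqP; rewrite addrC -subr_eq0 addrK => /eqP. Qed.

Lemma mapZ a x : f (a *: x) = a *: f x.
Proof. by rewrite -[a *: x]addr0 lf map0 addr0. Qed.

Lemma mapN x : f (- x) = - f x.
Proof. by rewrite -scaleN1r mapZ scaleN1r. Qed.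

Lemma mapB x y : f (x - y) = f x - f y.
Proof. by rewrite mapD mapN. Qed.

Lemma map_sum I (r : seq I) (P : pred I) F :
  f (\sum_(i <- r | P i) F i) = \sum_(i <- r | P i) f (F i).
Proof. exact: (big_morph f mapD map0). Qed.
End LinearMaps.

Lemma linear_iter (R : realType) (V : lmodType R) (f : V -> V) n :
  linear f -> linear (iter n f).
Proof. by move=> lf; elim: n => [//|n IH] a x y /=; rewrite IH lf. Qed.

Lemma linear_step (R : realType) (V : lmodType R) (f : V -> V) k :
  linear f -> linear (fun x => x + k *: f x).
Proof.
move=> lf a x y; rewrite lf !scalerDr !scalerA [k * a]mulrC -!addrA.
by congr (_ + _); rewrite addrCA.
Qed.

Lemma iter_comm (T : Type) (f g : T -> T) n x :
  (forall x, f (g x) = g (f x)) -> iter n f (g x) = g (iter n f x).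
Proof. by move=> fg; elim: n => //= n ->. Qed.

Section Hilbert.
Variables (R : realType) (V : lmodType R) (sp : V -> V -> R).
Hypothesis spI : real_inner sp.
Local Notation nm := (hnorm sp).

Let spl a x y z : sp (a *: x + y) z = a * sp x z + sp y z.
Proof. by case: spI. Qed.

Lemma spC x y : sp x y = sp y x. Proof. by case: spI. Qed.

Lemma sp_linl z : linear (sp^~ z : V -> R^o).
Proof. by move=> a x y; rewrite spl. Qed.

Lemma spDl x y z : sp (x + y) z = sp x z + sp y z.
Proof. exact: (mapD (sp_linl z)). Qed.

Lemma spZl a x z : sp (a *: x) z = a * sp x z.
Proof. exact: (mapZ (sp_linl z)). Qed.

Lemma spNl x z : sp (- x) z = - sp x z.
Proof. exact: (mapN (sp_linl z)). Qed.

Lemma sp0l z : sp 0 z = 0.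
Proof. exact: (map0 (sp_linl z)). Qed.

Lemma sp_suml I (r : seq I) (P : pred I) F z :
  sp (\sum_(i <- r | P i) F i) z = \sum_(i <- r | P i) sp (F i) z.
Proof. exact: (map_sum (sp_linl z)). Qed.

Lemma spDr x y z : sp z (x + y) = sp z x + sp z y.
Proof. by rewrite spC spDl !(spC z). Qed.

Lemma spZr a x z : sp z (a *: x) = a * sp z x.
Proof. by rewrite spC spZl spC. Qed.

Lemma spNr x z : sp z (- x) = - sp z x.
Proof. by rewrite spC spNl spC. Qed.

Lemma sp0r z : sp z 0 = 0.
Proof. by rewrite spC sp0l. Qed.

Definition spE := (spDl, spDr, spZl, spZr, spNl, spNr, sp0l, sp0r).

Lemma sp_ge0 x : 0 <= sp x x. Proof. by case: spI. Qed.

Lemma sp_inj x y : (forall z, sp x z = sp y z) -> x = y.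
Proof.
move=> xy; case: spI => _ _ _ sp0; apply/eqP; rewrite -subr_eq0; apply/eqP/sp0.
by rewrite !spE !xy; ring.
Qed.

Lemma nm_sq x : nm x ^+ 2 = sp x x.
Proof. by rewrite sqr_sqrtr ?sp_ge0. Qed.

Lemma nm_ge0 x : 0 <= nm x. Proof. exact: sqrtr_ge0. Qed.

Lemma nm_eq0 x : nm x = 0 -> x = 0.
Proof.
by move=> h; case: spI => _ _ _; apply; rewrite -nm_sq h expr0n.
Qed.

Lemma nm0 : nm 0 = 0. Proof. by rewrite /hnorm sp0l sqrtr0. Qed.

Lemma sp_young l x y : 0 < l -> 2 * sp x y <= l * nm x ^+ 2 + l^-1 * nm y ^+ 2.
Proof.
move=> l0; have := sp_ge0 (l *: x - y); rewrite !nm_sq !spE (spC y x) => h.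
have l1 : l^-1 * l = 1 by rewrite mulVf // gt_eqF.
have li : 0 < l^-1 by rewrite invr_gt0.
have : 0 <= l^-1 * (l * (l * sp x x + - sp x y) + - (l * sp x y + - sp y y)).
  by apply: mulr_ge0; [exact: ltW|lra].
rewrite (_ : _ * _ = (l^-1 * l) * (l * sp x x) - 2 * (l^-1 * l) * sp x y
  + l^-1 * sp y y); last ring.
by rewrite l1; lra.
Qed.

Lemma sp_le_nm x y : sp x y <= nm x * nm y.
Proof.
have x0 := nm_ge0 x; have y0 := nm_ge0 y.
have [xz|xn] := eqVneq (nm x) 0.
  by rewrite xz (nm_eq0 xz) sp0l mul0r.
have [yz|yn] := eqVneq (nm y) 0.
  by rewrite yz (nm_eq0 yz) sp0r mulr0.
have xp : 0 < nm x by rewrite lt_def xn.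
have yp : 0 < nm y by rewrite lt_def yn.
have := @sp_young (nm y / nm x) x y; rewrite divr_gt0 // => /(_ isT).
rewrite (_ : _ + _ = 2 * (nm x * nm y)); first by rewrite ler_pM2l ?ltr0n.
by field; rewrite xn yn.
Qed.

Lemma nmZ a x : nm (a *: x) = `|a| * nm x.
Proof.
rewrite /hnorm !spE mulrA -expr2 sqrtrM ?sqr_ge0 //.
by rewrite sqrtr_sqr.
Qed.

Lemma nmN x : nm (- x) = nm x.
Proof. by rewrite -scaleN1r nmZ normrN1 mul1r. Qed.

Lemma nmBC x y : nm (x - y) = nm (y - x).
Proof. by rewrite -nmN opprB. Qed.

Lemma nmD x y : nm (x + y) <= nm x + nm y.
Proof.
rewrite -ler_sqr ?nnegrE ?addr_ge0 ?nm_ge0 // nm_sq !spE (spC y x).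
by have := sp_le_nm x y; rewrite sqrrD !nm_sq => h; rewrite mulr2n; lra.
Qed.

Lemma nmB x y : nm (x - y) <= nm x + nm y.
Proof. by rewrite -(nmN y) nmD. Qed.

Lemma nm_sum I (r : seq I) (P : pred I) F :
  nm (\sum_(i <- r | P i) F i) <= \sum_(i <- r | P i) nm (F i).
Proof.
elim/big_rec2: _ => [|i y z _ h]; first by rewrite nm0.
by apply: le_trans (nmD _ _) _; rewrite lerD2l.
Qed.

Lemma nm_tri y x z : nm (x - z) <= nm (x - y) + nm (y - z).
Proof. by rewrite (le_trans _ (nmD _ _)) // addrA subrK. Qed.

Lemma sp_normle x y : `|sp x y| <= nm x * nm y.
Proof.
rewrite ler_norml sp_le_nm andbT lerNl -spNl.
by rewrite (le_trans (sp_le_nm _ _)) // nmN.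
Qed.

Lemma nm_le_sp x c : 0 <= c -> (forall y, sp x y <= c * nm y) -> nm x <= c.
Proof.
move=> c0 h; have := h x; rewrite -nm_sq expr2.
have [->//|n0] := eqVneq (nm x) 0.
by rewrite ler_pM2r // lt_def n0 nm_ge0.
Qed.

Lemma nm_small_eq x y : (forall e, 0 < e -> nm (x - y) <= e) -> x = y.
Proof.
move=> h; apply/eqP; rewrite -subr_eq0; apply/eqP/nm_eq0/le_anti.
by rewrite nm_ge0 andbT; apply/ler_addgt0Pl => e /h; rewrite addr0.
Qed.

Hypothesis Vc : complete_inner sp.

(* A minimising sequence of [nm x ^+ 2 - 2 * l x] is Cauchy by the
   parallelogram identity. *)
Lemma riesz (l : V -> R) c : (forall a x y, l (a *: x + y) = a * l x + l y) ->
  (forall x, `|l x| <= c * nm x) -> exists y, forall x, l x = sp y x.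
Proof.
move=> ll lc; have llin : linear (l : V -> R^o) by [].
have lD x y : l (x + y) = l x + l y := mapD llin x y.
have lZ a x : l (a *: x) = a * l x := mapZ llin a x.
pose phi x := nm x ^+ 2 - 2 * l x.
pose S := [set phi x | x in [set: V]]%classic.
have c0 x : - (c ^+ 2) <= phi x.
  rewrite /phi; have := lc x; rewrite ler_norml => /andP[_ h].
  by have := sqr_ge0 (nm x - c); rewrite sqrrB; lra.
have Slb : has_lbound S by exists (- c ^+ 2) => _ [x _ <-].
have Si : has_inf S by split=> //; exists (phi 0), 0.
have ap n : exists x, phi x <= inf S + n.+1%:R^-1.
  have /(inf_adherent)/(_ Si)[_ [x _ <-] h] : (0 : R) < n.+1%:R^-1 by rewrite invr_gt0.
  by exists x; apply: ltW.
have lowb x : inf S <= phi x by apply: ge_inf => //; exists x.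
have [u uP] := choice ap.
have ucauchy m n : nm (u m - u n) ^+ 2 <= 2 * m.+1%:R^-1 + 2 * n.+1%:R^-1.
  have := lowb (2^-1 *: (u m + u n)); have := uP m; have := uP n.
  rewrite /phi lZ lD !nm_sq !spE (spC (u n) (u m)).
  move: (inf S) (m.+1%:R^-1 : R) (n.+1%:R^-1 : R) => i a b.
  move: (sp (u n) _) (sp (u m) (u m)) (sp (u m) (u n)) (l (u n)) (l (u m)).
  by move=> *; lra.
have inv_small e : 0 < e -> exists N, forall n : nat, (N <= n)%N -> n.+1%:R^-1 <= e :> R.
  move=> e0; exists (Num.bound e^-1) => n hn.
  rewrite invf_ple ?posrE ?ltr0n //; apply: ltW.
  have e1 : 0 <= e^-1 by rewrite invr_ge0 ltW.
  apply: lt_le_trans (archi_boundP e1) _.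
  by rewrite ler_nat (leq_trans hn).
have [y yP] : exists y, forall e, 0 < e -> exists N, forall n, (N <= n)%N ->
    nm (u n - y) <= e.
  apply: Vc => e e0; have /inv_small[N NP] : 0 < e ^+ 2 / 4 by rewrite divr_gt0 ?exprn_gt0.
  exists N => m n /NP hm /NP hn.
  rewrite -ler_sqr ?nnegrE ?nm_ge0 ?(ltW e0) //.
  apply: le_trans (ucauchy m n) _; move: hm hn.
  by move: (m.+1%:R^-1 : R) (n.+1%:R^-1 : R) => a b; lra.
have near v n : (sp (u n) v - l v) ^+ 2 <= (nm v ^+ 2 + 1) * n.+1%:R^-1.
  (* Moving from [u n] to [u n - (d / w) v] lowers [phi] by [d^2 / w * (1 + 1 / w)], nearly the
     optimum along [v]; the summand [1] in [w] keeps the quotient meaningful for [v = 0]. *)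
  set d := sp (u n) v - l v; set w := nm v ^+ 2 + 1.
  have w0 : 0 < w by rewrite ltr_wpDl ?sqr_ge0.
  have := lowb (- (d / w) *: v + u n); have := uP n.
  rewrite /phi lD lZ !nm_sq !spE (spC v (u n)).
  have -> : sp (u n) v = d + l v by rewrite /d subrK.
  have -> : sp v v = w - 1 by rewrite /w addrK nm_sq.
  move=> h1 h2.
  have h3 : d ^+ 2 / w * (1 + w^-1) <= n.+1%:R^-1.
    move: h1 h2; set a := n.+1%:R^-1; set b := sp _ _; set lu := l (u n); set lv := l v.
    move=> h1 h2; have -> : d ^+ 2 / w * (1 + w^-1) =
      - (- (d / w) * (- (d / w) * (w - 1) + (d + lv)) + (- (d / w) * (d + lv) + b) -
         2 * (- (d / w) * lv + lu)) + (b - 2 * lu) by field; rewrite gt_eqF.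
    by lra.
  have : d ^+ 2 / w <= n.+1%:R^-1.
    apply: le_trans h3; rewrite ler_peMr ?divr_ge0 ?sqr_ge0 ?(ltW w0) //.
    by rewrite lerDl invr_ge0 ltW.
  by rewrite ler_pdivrMr // mulrC.
exists y => v; apply/eqP; rewrite eq_sym -subr_eq0.
have : `|sp y v - l v| <= 0.
  apply/ler_addgt0Pl => e e0; rewrite addr0.
  have /yP[N1 h1] : 0 < e / 2 / (nm v + 1) by rewrite !divr_gt0 // ltr_wpDl ?nm_ge0.
  have /inv_small[N2 h2] : 0 < (e / 2) ^+ 2 / (nm v ^+ 2 + 1).
    by rewrite divr_gt0 ?exprn_gt0 ?divr_gt0 // ltr_wpDl ?sqr_ge0.
  have {}h1 := h1 _ (leq_maxl N1 N2); have {}h2 := h2 _ (leq_maxr N1 N2).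
  set n := maxn N1 N2 in h1 h2.
  have -> : sp y v - l v = - sp (u n - y) v + (sp (u n) v - l v) by rewrite !spE; ring.
  apply: le_trans (ler_normD _ _) _; rewrite normrN.
  have e1 : `|sp (u n - y) v| <= e / 2.
    apply: le_trans (sp_normle _ _) _.
    move: h1; rewrite ler_pdivlMr ?ltr_wpDl ?nm_ge0 //.
    by have := nm_ge0 (u n - y); lra.
  have e2 : `|sp (u n) v - l v| <= e / 2.
    rewrite -ler_sqr ?nnegrE ?normr_ge0 ?divr_ge0 ?(ltW e0) //.
    rewrite real_normK ?num_real //; apply: le_trans (near v n) _.
    move: h2; rewrite ler_pdivlMr ?ltr_wpDl ?sqr_ge0 // => h2.
    by rewrite mulrC.
  by lra.
by rewrite normr_le0.
Qed.

Definition adjoint (f g : V -> V) := forall x y, sp (f x) y = sp x (g y).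

Lemma adjoint_exists f c : linear f -> (forall x, nm (f x) <= c * nm x) ->
  exists g, [/\ linear g, adjoint f g & adjoint g f].
Proof.
move=> lf fc.
have ap y : exists z, forall x, sp (f x) y = sp z x.
  apply: (@riesz _ (c * nm y)) => [a u v|x]; first by rewrite lf !spE.
  apply: le_trans (sp_normle _ _) _.
  by rewrite mulrAC ler_wpM2r ?nm_ge0.
have [g gP] := choice ap.
exists g; split=> [a x y|x y|x y].
- by apply: sp_inj => z; rewrite !spE -!gP !spE.
- by rewrite gP spC.
- by rewrite -gP spC.
Qed.

Lemma adjoint_bound f g c : 0 <= c -> adjoint f g ->
  (forall x, nm (f x) <= c * nm x) -> forall x, nm (g x) <= c * nm x.
Proof.
move=> c0 fg fc x; apply: nm_le_sp => [|y]; first by rewrite mulr_ge0 ?nm_ge0.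
rewrite spC -fg (le_trans (sp_le_nm _ _)) //.
by rewrite mulrAC ler_wpM2r ?nm_ge0.
Qed.

Lemma adjoint_iter f g n : adjoint f g -> adjoint (iter n f) (iter n g).
Proof.
by move=> fg; elim: n => // n IH x y; rewrite iterS fg IH -iterSr.
Qed.

End Hilbert.

(** * Neumann series and the Lyapunov energy estimate *)

Lemma expr_small (R : realType) (q e : R) : 0 <= q -> q < 1 -> 0 < e ->
  exists N, forall n, (N <= n)%N -> q ^+ n <= e.
Proof.
move=> q0 q1 e0; have q1' : `|q| < 1 by rewrite ger0_norm.
have /cvgr0Pnorm_le/(_ e e0) [N _ NP] := cvg_expr q1'.
exists N => n /NP; rewrite /= ger0_norm // exprn_ge0 //.
Qed.

Lemma geom_le (R : realType) (q : R) n : 0 <= q -> q < 1 ->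
  \sum_(i < n) q ^+ i <= (1 - q)^-1.
Proof.
move=> q0 q1; have p : 0 < 1 - q by rewrite subr_gt0.
rewrite -[_^-1]div1r ler_pdivlMr // mulrC.
by rewrite -opprB mulNr -subrX1 opprB gerBl exprn_ge0.
Qed.

Section Operators.
Variables (R : realType) (V : lmodType R) (sp : V -> V -> R).
Hypothesis spI : real_inner sp.
Hypothesis Vc : complete_inner sp.
Local Notation nm := (hnorm sp).
Let spE := spE spI.
Let nm_ge0 := nm_ge0 sp.

(** Only the iterates of [L] are controlled: [K] may exceed [1], so [L] itself need not be a
    contraction. Linearity of the limit [G] and the left inverse both come from uniqueness: a
    solution of [z = L z] equals all its iterates, hence vanishes. *)
Lemma neumann (L : V -> V) q K : linear L -> 0 <= q -> q < 1 -> 0 <= K ->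
  (forall n x, nm (iter n L x) <= K * q ^+ n * nm x) ->
  exists G : V -> V, [/\ linear G, (forall x, G x - L (G x) = x),
    (forall x, G (x - L x) = x) & (forall x, nm (G x) <= K / (1 - q) * nm x)].
Proof.
move=> lL q0 q1 K0 LK; have q1' : 0 < 1 - q by rewrite subr_gt0.
have fix0 z : z - L z = 0 -> z = 0.
  move=> /eqP; rewrite subr_eq0 => /eqP zL.
  have it n : iter n L z = z by elim: n => //= n ->.
  apply: (nm_eq0 spI); apply/le_anti; rewrite nm_ge0 andbT.
  apply/ler_addgt0Pl => e e0; rewrite addr0.
  have w0 : 0 < K * nm z + 1 by rewrite ltr_wpDl ?mulr_ge0 ?nm_ge0.
  have [N /(_ _ (leqnn N)) NP] := expr_small q0 q1 (divr_gt0 e0 w0).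
  rewrite -{1}(it N); apply: le_trans (LK N z) _.
  have h : q ^+ N * (K * nm z + 1) <= e by rewrite -ler_pdivlMr.
  by have := exprn_ge0 N q0; lra.
pose u x n := \sum_(k < n) iter k L x.
have uS x n : u x n - L (u x n) = x - iter n L x.
  elim: n => [|n IH]; rewrite /u ?big_ord0 ?(map0 lL) ?subrr //.
  rewrite big_ord_recr /= -/(u x n) (mapD lL) opprD addrACA IH.
  by rewrite addrA subrK.
have uD x n j : u x (n + j)%N = u x n + iter n L (u x j).
  rewrite /u big_split_ord /=; congr (_ + _).
  rewrite (map_sum (linear_iter n lL)); apply: eq_bigr => i _.
  by rewrite -iterD.
have ub x n : nm (u x n) <= K / (1 - q) * nm x.
  apply: le_trans (nm_sum spI _ _ _) _.
  apply: (@le_trans _ _ (\sum_(k < n) K * q ^+ k * nm x)).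
    by apply: ler_sum => k _; exact: LK.
  rewrite -mulr_suml -mulr_sumr ler_wpM2r ?nm_ge0 // ler_wpM2l //.
  exact: geom_le.
have ex x : exists l, forall e, 0 < e -> exists N, forall n, (N <= n)%N ->
    nm (u x n - l) <= e.
  apply: Vc => e e0; set w := K * (K / (1 - q) * nm x) + 1.
  have w0 : 0 < w by rewrite ltr_wpDl // !mulr_ge0 ?nm_ge0 // invr_ge0 ltW.
  have [N NP] := expr_small q0 q1 (divr_gt0 (divr_gt0 e0 (ltr0Sn _ 1)) w0).
  have close m : (N <= m)%N -> nm (u x m - u x N) <= e / 2.
    move=> /subnKC <-; rewrite uD addrC addKr.
    apply: le_trans (LK _ _) _.
    have := NP N (leqnn _); rewrite ler_pdivlMr // => h.
    apply: le_trans h.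
    rewrite mulrC mulrA [_ * K]mulrC mulrC ler_wpM2l ?exprn_ge0 //.
    by apply: ler_wpDr => //; rewrite ler_wpM2l.
  exists N => m n /close hm /close hn.
  apply: le_trans (nm_tri spI (u x N) _ _) _.
  by rewrite (nmBC spI (u x N)); lra.
have [G GP] := choice ex.
have Ge x : G x - L (G x) = x.
  apply: (nm_small_eq spI) => e e0; set w := 1 + K * q + K * nm x.
  have w0 : 0 < w by rewrite /w -addrA ltr_pwDl // addr_ge0 ?mulr_ge0 ?nm_ge0.
  have d0 : 0 < e / w by rewrite divr_gt0.
  have [N1 h1] := GP x _ d0; have [N2 h2] := expr_small q0 q1 d0.
  have {}h1 := h1 _ (leq_maxl N1 N2); have {}h2 := h2 _ (leq_maxr N1 N2).
  set n := maxn N1 N2 in h1 h2.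
  have -> : G x - L (G x) - x = - (u x n - G x) + (L (u x n - G x) - iter n L x).
    apply: (sp_inj spI) => z; have := congr1 (sp^~ z) (uS x n).
    by rewrite (mapB lL) !spE; lra.
  apply: le_trans (nmD spI _ _) _; rewrite (nmN spI).
  apply: le_trans (lerD (lexx _) (nmB spI _ _)) _.
  have := LK 1%N (u x n - G x); rewrite /= expr1 => h3.
  have := LK n x => h4.
  have h5 : K * q * nm (u x n - G x) <= K * q * (e / w) by rewrite ler_wpM2l ?mulr_ge0.
  have h6 : q ^+ n * (K * nm x) <= e / w * (K * nm x) by rewrite ler_wpM2r ?mulr_ge0 ?nm_ge0.
  have : w * (e / w) = e by rewrite mulrC divfK // gt_eqF.
  by rewrite {1}/w; lra.
have Gu z x : z - L z = x -> z = G x.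
  move=> zx; apply/eqP; rewrite -subr_eq0; apply/eqP/fix0.
  apply: (sp_inj spI) => y; have := congr1 (sp^~ y) zx.
  by have := congr1 (sp^~ y) (Ge x); rewrite (mapB lL) !spE; lra.
exists G; split=> // [a x y|x|x].
- apply/esym/Gu; apply: (sp_inj spI) => z.
  have := congr1 (sp^~ z) (Ge x); have := congr1 (sp^~ z) (Ge y).
  rewrite lL !spE => <- <-; ring.
- exact/esym/Gu.
- apply/ler_addgt0Pl => e e0; have [N /(_ _ (leqnn N)) NP] := GP x e e0.
  rewrite -[G x](subrK (u x N)); apply: le_trans (nmD spI _ _) _.
  by rewrite (nmBC spI) lerD.
Qed.

Section Energy.
Variables (C : V -> V) (K h : R).
Hypotheses (lC : linear C) (K1 : 1 <= K) (h0 : 0 < h).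
Hypothesis CK : forall n x, nm (iter n C x) <= K * nm x.

Let K0 : 0 <= K. Proof. exact: le_trans ler01 K1. Qed.

(* [B] is the inverse of [(C - 1) / h - r]. *)
Definition shifted_inverse r (B : V -> V) :=
  [/\ linear B, (forall x, C (B x) = (1 + r * h) *: B x + h *: x),
      (forall x, B (C x) = (1 + r * h) *: B x + h *: x) &
      (forall x, nm (B x) <= K / r * nm x)].

(** The discrete counterpart of [exp (- r * h)], from one implicit Euler step. *)
Definition ratio r := (1 + r * h)^-1.

Lemma ratioK r : 0 < r -> ratio r * (1 + r * h) = 1.
Proof. by move=> r0; rewrite mulVf // gt_eqF // ltr_pwDl // mulr_ge0 // ltW. Qed.

Lemma ratio_gt0 r : 0 < r -> 0 < ratio r.
Proof. by move=> r0; rewrite invr_gt0 ltr_pwDl // mulr_ge0 // ltW. Qed.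

Lemma ratio_lt1 r : 0 < r -> ratio r < 1.
Proof.
by move=> r0; rewrite invf_lt1 ?ltrDl ?mulr_gt0 // ltr_pwDl // mulr_ge0 // ltW.
Qed.

Lemma ratio_sub r : 0 < r -> h * ratio r / (1 - ratio r) = r^-1.
Proof.
move=> r0; have q1 : 1 - ratio r != 0 by rewrite subr_eq0 eq_sym lt_eqF ?ratio_lt1.
have e : 1 - ratio r = r * (h * ratio r).
  by rewrite -{1}(ratioK r0); ring.
apply: (mulIf q1); rewrite divfK // e; field.
by rewrite gt_eqF.
Qed.

Lemma shifted_inverse_exists r : 0 < r -> exists B, shifted_inverse r B.
Proof.
move=> r0; set q := ratio r.
have q0 : 0 < q := ratio_gt0 r0; have q1 : q < 1 := ratio_lt1 r0.
have lL : linear (fun x => q *: C x).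
  by move=> a x y; rewrite lC scalerDr !scalerA mulrC.
have it n x : iter n (fun x => q *: C x) x = q ^+ n *: iter n C x.
  elim: n => [|n IH]; first by rewrite expr0 scale1r.
  by rewrite !iterS IH (mapZ lC) scalerA -exprS.
have LK n x : nm (iter n (fun x => q *: C x) x) <= K * q ^+ n * nm x.
  rewrite it (nmZ spI) ger0_norm ?exprn_ge0 ?(ltW q0) // -mulrA mulrCA.
  by rewrite ler_wpM2l ?exprn_ge0 ?(ltW q0).
have [G [lG GR GL GK]] := neumann lL (ltW q0) q1 K0 LK.
have qr : q * (1 + r * h) = 1 := ratioK r0.
have qi : (1 + r * h) * q = 1 by rewrite mulrC.
(* Since [(C - 1) / h - r = - (1 - q C) / (h q)], its inverse is [- h q] times the Neumann inverse
   [G] of [1 - q C]. *)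
exists (fun x => - (h * q) *: G x); split.
- by move=> a x y; rewrite lG scalerDr !scalerA mulrC.
- move=> x; rewrite (mapZ lC); apply: (sp_inj spI) => z.
  have := congr1 (sp^~ z) (GR x); rewrite !spE => gx.
  rewrite -gx; rewrite (_ : (1 + r * h) * (- (h * q) * _) =
    (- h * sp (G x) z) * ((1 + r * h) * q)); last ring.
  by rewrite qi; ring.
- move=> x; apply: (sp_inj spI) => z.
  have := congr1 (sp^~ z) (GL x).
  rewrite (mapB lG) (mapZ lG) !spE => gx.
  rewrite -gx; rewrite (_ : (1 + r * h) * (- (h * q) * _) =
    (- h * sp (G x) z) * ((1 + r * h) * q)); last ring.
  by rewrite qi; ring.
- move=> x; rewrite (nmZ spI) normrN ger0_norm ?mulr_ge0 ?(ltW h0) ?(ltW q0) //.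
  have := ler_wpM2l (mulr_ge0 (ltW h0) (ltW q0)) (GK x).
  have -> : h * q * (K / (1 - q) * nm x) = K * (h * q / (1 - q)) * nm x by ring.
  by rewrite ratio_sub.
Qed.

(* Discretisation of the Lyapunov form [int_0^oo exp(-2 r s) |T s x|^2 ds]. *)
Definition lyap r m x :=
  \sum_(k < m) h * ratio r ^+ k.*2.+1 * nm (iter k C x) ^+ 2.

Definition lyap2 r m x y :=
  \sum_(k < m) h * ratio r ^+ k.*2.+1 * sp (iter k C x) (iter k C y).

Let wgt_ge0 r k : 0 < r -> 0 <= h * ratio r ^+ k.
Proof. by move=> r0; rewrite mulr_ge0 ?exprn_ge0 ?(ltW h0) // ltW // ratio_gt0. Qed.

Lemma lyap_ge0 r m x : 0 < r -> 0 <= lyap r m x.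
Proof. by move=> r0; apply: sumr_ge0 => k _; rewrite mulr_ge0 ?sqr_ge0 ?wgt_ge0. Qed.

Lemma lyapD r m x y a :
  lyap r m (x + a *: y) = lyap r m x + 2 * a * lyap2 r m x y + a ^+ 2 * lyap r m y.
Proof.
rewrite /lyap /lyap2 !mulr_sumr -!big_split /=; apply: eq_bigr => k _.
rewrite (mapD (linear_iter k lC)) (mapZ (linear_iter k lC)) !(nm_sq spI) !spE.
by rewrite (spC spI (iter k C y)); ring.
Qed.

(** Bounding [q ^ (2 k + 1)] by [q ^ (k + 1)] gives up a factor [2] against the integral
    [1 / (2 r)], but reduces the sum to the geometric series evaluated by [ratio_sub]. *)
Lemma wgt_sum r m : 0 < r -> \sum_(k < m) h * ratio r ^+ k.*2.+1 <= r^-1.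
Proof.
move=> r0; have q0 := ratio_gt0 r0; have q1 := ratio_lt1 r0.
apply: (@le_trans _ _ (\sum_(k < m) h * ratio r * ratio r ^+ k)).
  apply: ler_sum => k _; rewrite exprS mulrA ler_wpM2l ?mulr_ge0 ?(ltW h0) ?(ltW q0) //.
  by rewrite ler_wiXn2l ?(ltW q0) ?(ltW q1) // -addnn leq_addr.
rewrite -mulr_sumr -(ratio_sub r0) ler_wpM2l ?mulr_ge0 ?(ltW h0) ?(ltW q0) //.
by rewrite geom_le // ltW.
Qed.

Lemma lyap_le r m x : 0 < r -> lyap r m x <= K ^+ 2 / r * nm x ^+ 2.
Proof.
move=> r0; apply: (@le_trans _ _ (\sum_(k < m) h * ratio r ^+ k.*2.+1 * (K ^+ 2 * nm x ^+ 2))).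
  apply: ler_sum => k _; rewrite ler_wpM2l ?wgt_ge0 // -exprMn.
  by rewrite ler_sqr ?nnegrE ?mulr_ge0 ?nm_ge0.
rewrite -mulr_suml (_ : _ / r * _ = r^-1 * (K ^+ 2 * nm x ^+ 2)); last ring.
by rewrite ler_wpM2r ?mulr_ge0 ?sqr_ge0 // wgt_sum.
Qed.

(** Telescoping form of the Lyapunov identity. With [a = C^m (B x)] and [v = C^m x], the equation
    for [B] reads [q C a - a = h q v]; the odd exponent of the weight thus turns the [m]-th summand
    into [q ^ (2 m)] times [sp (q C a - a) a]. The square of [q C a - a] left over in the difference
    of consecutive norms has the favourable sign, so discretising only turns the identity into an
    inequality. *)
Lemma lyap2_resolvent r B m x : 0 < r -> shifted_inverse r B ->
  2 * lyap2 r m x (B x) <= (ratio r ^+ m) ^+ 2 * nm (iter m C (B x)) ^+ 2 - nm (B x) ^+ 2.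
Proof.
move=> r0 [lB CB _ _]; set q := ratio r; set w := B x.
elim: m => [|m IH]; first by rewrite /lyap2 big_ord0 expr0 /=; lra.
rewrite /lyap2 big_ord_recr /= -/(lyap2 r m x w) mulrDr -/q.
set a := iter m C w; set v := iter m C x.
have Ca : C a = (1 + r * h) *: a + h *: v.
  rewrite /a -iter_comm // CB (mapD (linear_iter m lC)).
  by rewrite !(mapZ (linear_iter m lC)).
have qr : q * (1 + r * h) = 1 := ratioK r0.
have hv : q *: C a = a + (h * q) *: v.
  by rewrite Ca scalerDr !scalerA qr scale1r [q * h]mulrC.
have := sp_ge0 spI (q *: C a - a).
have e1 : h * sp v a * q = sp (q *: C a - a) a by rewrite hv addrC addKr !spE; ring.
rewrite (_ : h * q ^+ m.*2.+1 * sp v a = (q ^+ m) ^+ 2 * sp (q *: C a - a) a); last first.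
  by rewrite -e1 exprS -muln2 exprM; move: (q ^+ m) => p; ring.
have -> : (q ^+ m.+1) ^+ 2 * nm (C a) ^+ 2 = (q ^+ m) ^+ 2 * nm (q *: C a) ^+ 2.
  by rewrite !(nm_sq spI) !spE (exprS q m); move: (q ^+ m) => p; ring.
have m0 : 0 <= (q ^+ m) ^+ 2 := sqr_ge0 _.
move=> /(mulr_ge0 m0); move: IH; rewrite -/a -/q !(nm_sq spI) !spE (spC spI a).
move: (q ^+ m) (sp a a) (sp (C a) a) (sp (C a) (C a)) (lyap2 _ _ _ _) (sp w w).
by move=> *; lra.
Qed.

(** In the expansion of [lyap] along [B x], the first-order term yields [- k / 2] times
    [nm (B x) ^+ 2], one half of the dissipation being lost to the truncation at [m]. The
    second-order term takes at most half of what remains, because [k] is small relative to [r]. *)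
Lemma lyap_step r B k m x : 0 < r -> shifted_inverse r B -> 0 < k ->
  k * (K ^+ 2 / r) <= 1 / 4 -> K ^+ 2 * (ratio r ^+ m) ^+ 2 <= 1 / 2 ->
  lyap r m (x + k *: B x) + k / 4 * nm (B x) ^+ 2 <= lyap r m x.
Proof.
move=> r0 rB k0 kr mK; rewrite lyapD.
have h1 := lyap2_resolvent m x r0 rB.
have h2 := lyap_le m (B x) r0.
have h3 : (ratio r ^+ m) ^+ 2 * nm (iter m C (B x)) ^+ 2 <= 1 / 2 * nm (B x) ^+ 2.
  apply: le_trans (ler_wpM2r (sqr_ge0 (nm (B x))) mK).
  have -> : K ^+ 2 * (ratio r ^+ m) ^+ 2 * nm (B x) ^+ 2 =
    (ratio r ^+ m) ^+ 2 * (K * nm (B x)) ^+ 2 by move: (ratio r ^+ m) => p; ring.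
  rewrite ler_wpM2l ?sqr_ge0 //.
  by rewrite ler_sqr ?nnegrE ?mulr_ge0 ?nm_ge0.
have h4 : k * (2 * lyap2 r m x (B x)) <= k * (- (1 / 2) * nm (B x) ^+ 2).
  by rewrite ler_wpM2l ?(ltW k0) //; lra.
have h5 : k ^+ 2 * lyap r m (B x) <= k * (1 / 4 * nm (B x) ^+ 2).
  rewrite expr2 -mulrA ler_wpM2l ?(ltW k0) //.
  apply: le_trans (ler_wpM2l (ltW k0) h2) _.
  by rewrite mulrA ler_wpM2r ?sqr_ge0.
by lra.
Qed.

Lemma energy_sum r B k Th x N : 0 < r -> shifted_inverse r B -> 0 < k ->
  k * (K ^+ 2 / r) <= 1 / 4 -> (forall m, lyap r m x <= Th) ->
  k * \sum_(i < N) nm (B (iter i (fun y => y + k *: B y) x)) ^+ 2 <= 4 * Th.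
Proof.
move=> r0 rB k0 kr FT; have q0 := ratio_gt0 r0; have q1 := ratio_lt1 r0.
have K2 : 0 < K ^+ 2 by rewrite exprn_gt0 // (lt_le_trans ltr01).
have [m mP] : exists m, K ^+ 2 * (ratio r ^+ m) ^+ 2 <= 1 / 2.
  have d0 : 0 < (1 / 2) / K ^+ 2 by rewrite divr_gt0.
  have [m /(_ _ (leq_addr m m))] := expr_small (ltW q0) q1 d0.
  by rewrite exprD -expr2 ler_pdivlMr // mulrC => ?; exists m.
suff : lyap r m (iter N (fun y => y + k *: B y) x) +
    k / 4 * \sum_(i < N) nm (B (iter i (fun y => y + k *: B y) x)) ^+ 2 <= lyap r m x.
  have := lyap_ge0 m (iter N (fun y => y + k *: B y) x) r0; have := FT m; lra.
elim: N => [|N IH]; first by rewrite big_ord0 mulr0 addr0.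
rewrite big_ord_recr /= mulrDr; apply: le_trans IH.
have := lyap_step (iter N (fun y => y + k *: B y) x) r0 rB k0 kr mP.
by lra.
Qed.

End Energy.
End Operators.

(** * Comparing Euler steps for different shifts *)

Definition euler (R : realType) (V : lmodType R) (k : R) (B : V -> V) x :=
  x + k *: B x.

Section Ladder.
Variables (R : realType) (V : lmodType R) (sp : V -> V -> R).
Hypothesis spI : real_inner sp.
Hypothesis Vc : complete_inner sp.
Local Notation nm := (hnorm sp).
Let spE := spE spI.
Let nm_ge0 := nm_ge0 sp.
Variables (C : V -> V) (K h : R).
Hypotheses (lC : linear C) (K1 : 1 <= K) (h0 : 0 < h).
Hypothesis CK : forall n x, nm (iter n C x) <= K * nm x.
Local Notation sinv := (shifted_inverse sp C K h).

Let K0 : 0 <= K. Proof. exact: le_trans ler01 K1. Qed.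

(** Cauchy-Schwarz for the Duhamel sum, with Young's weight [l] left free. Adjoints move [B'] and
    the Euler factors in front of it to [z], so each summand pairs a term of the energy sum of [x]
    at [r] with a term of the adjoint energy sum of [z] at [r']. The second is bounded by power
    boundedness alone, so decay is asked of the orbit of [x] only, through [Th]. *)
Lemma bilinear_bound r r' B B' k Th d l x z N :
  0 < r -> 0 < r' -> sinv r B -> sinv r' B' -> 0 < k ->
  k * (K ^+ 2 / r) <= 1 / 4 -> k * (K ^+ 2 / r') <= 1 / 4 ->
  (forall m, lyap sp C h r m x <= Th) -> 0 < l ->
  2 * (k * \sum_(i < N)
    d * sp (iter (N - i.+1) (euler k B') (B' (B (iter i (euler k B) x)))) z)
  <= l * (d ^+ 2 * (4 * Th)) + l^-1 * (4 * (K ^+ 2 / r' * nm z ^+ 2)).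
Proof.
move=> r0 r'0 rB rB' k0 kr kr' FT l0.
have CK1 x0 : nm (C x0) <= K * nm x0 := CK 1 x0.
have [C' [lC' CC' _]] := adjoint_exists spI Vc lC CK1.
have [lB' CB' BC' BK'] := rB'.
have [Ba [lBa BBa _]] := adjoint_exists spI Vc lB' BK'.
have CK' n y : nm (iter n C' y) <= K * nm y.
  exact: (adjoint_bound spI K0 (adjoint_iter n CC') (CK n)).
(* Taking adjoints exchanges the two commutation identities of [shifted_inverse]. *)
have rBa : shifted_inverse sp C' K h r' Ba.
  split=> // [y|y|y].
  - by apply: (sp_inj spI) => v; rewrite spC // -CC' -BBa BC' !spE (spC spI _ v) BBa (spC spI _ v).
  - by apply: (sp_inj spI) => v; rewrite spC // -BBa -CC' CB' !spE (spC spI _ v) BBa (spC spI _ v).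
  - by apply: (adjoint_bound spI _ BBa BK'); rewrite divr_ge0 // ltW.
have WWa : adjoint sp (euler k B') (euler k Ba).
  by move=> u v; rewrite /euler !spE BBa.
have E1 := energy_sum spI lC K1 h0 CK N r0 rB k0 kr FT.
have E2 := energy_sum spI lC' K1 h0 CK' N r'0 rBa k0 kr'
  (fun m => lyap_le K1 h0 CK' m z r'0).
(* The orbit of [z] runs backwards: the [i]-th summand carries [N - i.+1] adjoint steps. *)
rewrite (reindex_inj rev_ord_inj) /= in E2.
have young (i : 'I_N) : 2 * (d * sp (iter (N - i.+1) (euler k B') (B' (B (iter i (euler k B) x)))) z)
    <= l * (d ^+ 2 * nm (B (iter i (euler k B) x)) ^+ 2) +
       l^-1 * nm (Ba (iter (N - i.+1) (euler k Ba) z)) ^+ 2.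
  rewrite (adjoint_iter _ WWa) BBa.
  rewrite -(spZl spI); have := sp_young spI (d *: B (iter i (euler k B) x))
    (Ba (iter (N - i.+1) (euler k Ba) z)) l0.
  by rewrite (nmZ spI) exprMn real_normK ?num_real.
apply: (@le_trans _ _ (k * \sum_(i < N) (l * (d ^+ 2 * nm (B (iter i (euler k B) x)) ^+ 2) +
       l^-1 * nm (Ba (iter (N - i.+1) (euler k Ba) z)) ^+ 2))).
  rewrite mulrCA ler_wpM2l ?(ltW k0) // mulr_sumr.
  by apply: ler_sum => i _; exact: young.
rewrite big_split /= -!mulr_sumr mulrDr; apply: lerD.
  rewrite mulrCA ler_wpM2l ?(ltW l0) // mulrCA ler_wpM2l ?sqr_ge0 //.
by rewrite mulrCA ler_wpM2l ?invr_ge0 ?(ltW l0).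
Qed.

Lemma resolvent_identity r r' B B' x : 0 < r' -> sinv r B -> sinv r' B' ->
  B x - B' x = (r - r') *: B' (B x).
Proof.
move=> r'0 [lB CB _ _] [lB' _ BC' _].
have := BC' (B x); rewrite CB (mapD lB') !(mapZ lB') => e.
apply: (sp_inj spI) => z; have := congr1 (sp^~ z) e; rewrite !spE => {}e.
apply: (mulfI (lt0r_neq0 h0)); lra.
Qed.

(** Discrete Duhamel formula: [f] acts before the [i]-th step, [g] after it. *)
Lemma iter_diff (f g : V -> V) x n : linear g ->
  iter n f x - iter n g x =
  \sum_(i < n) iter (n - i.+1) g (f (iter i f x) - g (iter i f x)).
Proof.
move=> lg; elim: n => [|n IH]; first by rewrite big_ord0 subrr.
rewrite big_ord_recr /= subnn /=.
have -> : f (iter n f x) - g (iter n g x) =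
    g (iter n f x - iter n g x) + (f (iter n f x) - g (iter n f x)).
  by rewrite (mapB lg) [RHS]addrC addrA subrK.
congr (_ + _); rewrite IH (map_sum lg); apply: eq_bigr => i _.
by rewrite -iterS -subSn.
Qed.

(** The difference [z] is tested against itself: the Duhamel sum becomes [nm z ^+ 2], and [l] is
    chosen so that the second half of [bilinear_bound] is also [nm z ^+ 2] and can be absorbed. *)
Lemma euler_diff r r' B B' k Th x n :
  0 < r -> 0 < r' -> sinv r B -> sinv r' B' -> 0 < k ->
  k * (K ^+ 2 / r) <= 1 / 4 -> k * (K ^+ 2 / r') <= 1 / 4 ->
  (forall m, lyap sp C h r m x <= Th) ->
  nm (iter n (euler k B) x - iter n (euler k B') x) ^+ 2 <=
    16 * K ^+ 2 * (r - r') ^+ 2 * Th / r'.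
Proof.
move=> r0 r'0 rB rB' k0 kr kr' FT; set z := _ - _.
have l0 : 0 < 4 * K ^+ 2 / r'.
  by rewrite divr_gt0 // mulr_gt0 // exprn_gt0 // (lt_le_trans ltr01).
have := bilinear_bound (r - r') z n r0 r'0 rB rB' k0 kr kr' FT l0.
have [lB' _ _ _] := rB'; have lW' := linear_step k lB'.
have -> : k * \sum_(i < n) (r - r') *
    sp (iter (n - i.+1) (euler k B') (B' (B (iter i (euler k B) x)))) z = nm z ^+ 2.
  rewrite (nm_sq spI) {2}/z (iter_diff _ _ _ lW') (sp_suml spI) mulr_sumr.
  apply: eq_bigr => i _; set y := iter i _ x.
  have -> : euler k B y - euler k B' y = (k * (r - r')) *: B' (B y).
    rewrite /euler opprD addrACA subrr add0r -scalerBr.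
    by rewrite (resolvent_identity _ r'0 rB rB') scalerA.
  by rewrite (mapZ (linear_iter _ lW')) spE mulrA.
have -> : (4 * K ^+ 2 / r')^-1 * (4 * (K ^+ 2 / r' * nm z ^+ 2)) = nm z ^+ 2.
  by field; rewrite !gt_eqF // (lt_le_trans ltr01).
have -> : 4 * K ^+ 2 / r' * ((r - r') ^+ 2 * (4 * Th)) =
  16 * K ^+ 2 * (r - r') ^+ 2 * Th / r' by ring.
by lra.
Qed.

Lemma euler_pow_bound (B : V -> V) k c n x : 0 <= k -> 0 <= c ->
  (forall x, nm (B x) <= c * nm x) ->
  nm (iter n (euler k B) x) <= expR (n%:R * k * c) * nm x.
Proof.
move=> k0 c0 Bc; elim: n => [|n IH]; first by rewrite !mul0r expR0 mul1r.
rewrite iterS /euler; apply: le_trans (nmD spI _ _) _.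
rewrite (nmZ spI) ger0_norm //.
set y := iter n _ x in IH *.
apply: (@le_trans _ _ ((1 + k * c) * nm y)).
  by rewrite mulrDl mul1r lerD2l -mulrA ler_wpM2l.
apply: le_trans (ler_wpM2l _ IH) _; first by rewrite addr_ge0 ?mulr_ge0.
rewrite mulrA ler_wpM2r ?nm_ge0 // -natr1.
rewrite (_ : (_ + 1) * k * c = k * c + n%:R * k * c); last ring.
rewrite expRD.
by rewrite ler_wpM2r ?expR_ge0 // expR_ge1Dx.
Qed.

(** For the shifts [r] and [16 r], with energy at most [K^2 / r], [euler_diff] gives [16 K^2 (15
    r)^2 (K^2 / r) / (16 r) = (15 K^2)^2], independent of [r]. After [J] rungs the shift is at least
    the total time [n k], and the norm bound [K / shift] keeps the Euler product below [exp K]. *)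
Lemma ladder_up J r B x n k : 0 < r -> sinv r B -> 0 < k ->
  k * (K ^+ 2 / r) <= 1 / 4 -> n%:R * k <= 16 ^+ J * r ->
  nm (iter n (euler k B) x) <= (15 * K ^+ 2 * J%:R + expR K) * nm x.
Proof.
elim: J r B => [|J IH] r B r0 rB k0 kr nk.
  rewrite mulr0 add0r; have [_ _ _ Br] := rB.
  have c0 : 0 <= K / r by rewrite divr_ge0 // ltW.
  apply: le_trans (euler_pow_bound n x (ltW k0) c0 Br) _.
  rewrite ler_wpM2r ?nm_ge0 // ler_expR mulrCA ler_piMr //.
  by rewrite ler_pdivrMr // mul1r; rewrite expr0 mul1r in nk.
have r'0 : 0 < 16 * r by rewrite mulr_gt0.
have [B' rB'] := shifted_inverse_exists spI Vc lC K1 h0 CK r'0.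
have kr' : k * (K ^+ 2 / (16 * r)) <= 1 / 4.
  apply: le_trans kr; rewrite ler_wpM2l ?(ltW k0) // ler_wpM2l ?sqr_ge0 //.
  by rewrite lef_pV2 ?posrE //; lra.
have nk' : n%:R * k <= 16 ^+ J * (16 * r) by rewrite mulrA -exprSr.
have {}IH := IH _ _ r'0 rB' k0 kr' nk'.
have := euler_diff n r0 r'0 rB rB' k0 kr kr' (fun m => lyap_le K1 h0 CK m x r0).
set d := nm _ => hd.
have {}hd : d <= 15 * K ^+ 2 * nm x.
  rewrite -ler_sqr ?nnegrE ?nm_ge0 ?mulr_ge0 ?sqr_ge0 //.
  apply: le_trans hd _; rewrite le_eqVlt; apply/orP; left; apply/eqP.
  by field; rewrite gt_eqF.
rewrite -[iter n _ x](subrK (iter n (euler k B') x)).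
apply: le_trans (nmD spI _ _) _; apply: le_trans (lerD hd IH) _.
by rewrite -natr1; lra.
Qed.

(** All factors commute, so with both shifts equal to [1] every summand of [bilinear_bound] is the
    same number [nm z ^+ 2]; a sum of equal terms bounded by energies decays like the inverse of the
    elapsed time. *)
Lemma euler_landau B x n k : sinv 1 B -> 0 < k -> k * K ^+ 2 <= 1 / 4 ->
  n%:R * k * nm (B (B (iter n (euler k B) x))) <= 4 * K ^+ 2 * nm x.
Proof.
move=> rB k0 kr; have [lB _ _ _] := rB; have lW := linear_step k lB.
(* The sum has [n.+1] terms, since each of them contains only [n] Euler factors. *)
set z := B _; set t := n.+1%:R * k.
have t0 : 0 < t by rewrite mulr_gt0.
have kr1 : k * (K ^+ 2 / 1) <= 1 / 4 by rewrite divr1.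
have l0 : 0 < 4 * K ^+ 2 / t.
  by rewrite divr_gt0 // mulr_gt0 // exprn_gt0 // (lt_le_trans ltr01).
have := bilinear_bound 1 z n.+1 ltr01 ltr01 rB rB k0 kr1 kr1
  (fun m => lyap_le K1 h0 CK m x ltr01) l0.
have -> : k * \sum_(i < n.+1) 1 * sp (iter (n.+1 - i.+1) (euler k B) (B (B (iter i (euler k B) x)))) z
    = t * nm z ^+ 2.
  rewrite (eq_bigr (fun=> nm z ^+ 2)); last first.
    move=> i _; rewrite mul1r (nm_sq spI) subSS.
    have BW y : euler k B (B y) = B (euler k B y) by rewrite /euler (mapD lB) (mapZ lB).
    by rewrite !(iter_comm _ _ BW) -iterD subnK ?leq_ord.
  by rewrite sumr_const card_ord -mulr_natl mulrA [k * _]mulrC.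
have -> : (4 * K ^+ 2 / t)^-1 * (4 * (K ^+ 2 / 1 * nm z ^+ 2)) = t * nm z ^+ 2.
  by field; rewrite !gt_eqF // (lt_le_trans ltr01).
have -> : 4 * K ^+ 2 / t * (1 ^+ 2 * (4 * (K ^+ 2 / 1 * nm x ^+ 2))) =
  (4 * K ^+ 2 * nm x) ^+ 2 / t by field; rewrite gt_eqF.
move=> hz; have {}hz : t * nm z ^+ 2 <= (4 * K ^+ 2 * nm x) ^+ 2 / t by lra.
apply: (@le_trans _ _ (t * nm z)).
  by rewrite ler_wpM2r ?nm_ge0 // ler_wpM2r ?(ltW k0) // ler_nat.
rewrite -ler_sqr ?nnegrE ?mulr_ge0 ?nm_ge0 ?sqr_ge0 ?(ltW t0) ?(ltW k0) //.
by rewrite exprMn expr2 -mulrA mulrC -ler_pdivlMr.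
Qed.

(* The resolvent identity bounds [B z] by [z / J] and [J B (B z)] for any [J]; taking
   [J] of order [t] balances [euler_landau] against [ladder_up]. *)
Lemma euler_inverse_bound B x n k : sinv 1 B -> 0 < k -> k * K ^+ 2 <= 1 / 4 ->
  nm (iter n (euler k B) (B x)) <= (15 * K ^+ 3 + 3 * K * expR K + 8 * K ^+ 2 * (1 + K)) * nm x.
Proof.
move=> rB k0 kr; have [lB _ _ BK] := rB; have lW := linear_step k lB.
set t := n%:R * k; have t0 : 0 <= t by rewrite /t mulr_ge0 // ltW.
have x0 := nm_ge0 x; have eK := expR_ge0 K.
have [t1|t1] := leP t 1.
  apply: le_trans (euler_pow_bound n (B x) (ltW k0) K0 _) _.
    by move=> y; have := BK y; rewrite divr1.
  apply: (@le_trans _ _ (expR K * (K * nm x))).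
    apply: ler_pM; rewrite ?expR_ge0 //; last by have := BK x; rewrite divr1.
    by rewrite ler_expR ler_piMl.
  have -> : expR K * (K * nm x) = K * expR K * nm x by ring.
  rewrite ler_wpM2r //.
  have : 0 <= K ^+ 3 by rewrite exprn_ge0.
  have : 0 <= K ^+ 2 * (1 + K) by rewrite mulr_ge0 ?sqr_ge0 ?addr_ge0.
  have : 0 <= K * expR K by rewrite mulr_ge0.
  by lra.
(* [J] is comparable with [t] itself, not with its logarithm: the linear growth in [J] allowed by
   [ladder_up] is cancelled by the factor [K / (1 + J)] from the resolvent at [1 + J]. *)
have [J [J1 Jt tJ tJ16]] : exists J : nat, [/\ 0 < J%:R :> R, J%:R <= 2 * t, t <= J%:R & t <= 16 ^+ J * 1].
  exists (Num.trunc t).+1.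
  have /andP[a b] : (Num.trunc t)%:R <= t < (Num.trunc t).+1%:R by apply: truncn_itv.
  split=> //; first by rewrite -natr1; lra.
  - exact: ltW.
  - rewrite mulr1; apply: le_trans (ltW b) _; rewrite -natrX ler_nat.
    by apply: ltnW; apply: ltn_expl.
set z := iter n (euler k B) x.
have kr1 : k * (K ^+ 2 / 1) <= 1 / 4 by rewrite divr1.
have hz : nm z <= (15 * K ^+ 2 * J%:R + expR K) * nm x.
  by apply: (ladder_up x ltr01 rB k0 kr1).
have hzz : t * nm (B (B z)) <= 4 * K ^+ 2 * nm x by exact: euler_landau.
have BW y : euler k B (B y) = B (euler k B y) by rewrite /euler (mapD lB) (mapZ lB).
rewrite (iter_comm _ _ BW) -/z.
have s0 : 0 < 1 + J%:R :> R by rewrite ltr_pwDl // ltW.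
have [B' rB'] := shifted_inverse_exists spI Vc lC K1 h0 CK s0.
have [lB' _ _ BK'] := rB'.
(* The resolvent identity at [z] leaves [B' (B z)]; used again at [B z], it trades this vector for
   terms in [B (B z)]. *)
have e : B z = B' z - J%:R *: (B (B z) + J%:R *: B' (B (B z))).
  have e1 := resolvent_identity z s0 rB rB'.
  have e2 := resolvent_identity (B z) s0 rB rB'.
  apply: (sp_inj spI) => y.
  have := congr1 (sp^~ y) e1; have := congr1 (sp^~ y) e2; rewrite !spE => h2 h1.
  have h2' : sp (B (B z)) y + J%:R * sp (B' (B (B z))) y = sp (B' (B z)) y by lra.
  by rewrite h2'; lra.
set w := B (B z) in e hzz *.
have w0 := nm_ge0 w.
rewrite e; apply: le_trans (nmB spI _ _) _; rewrite (nmZ spI) (ger0_norm (ltW J1)).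
have hb1 : nm (B' z) <= (15 * K ^+ 3 + K * expR K) * nm x.
  apply: le_trans (BK' z) _.
  apply: (@le_trans _ _ (K / (1 + J%:R) * ((15 * K ^+ 2 * J%:R + expR K) * nm x))).
    by rewrite ler_wpM2l // divr_ge0 // ltW.
  rewrite mulrA ler_wpM2r // mulrAC ler_pdivrMr //.
  have : 0 <= K ^+ 3 by rewrite exprn_ge0.
  have : 0 <= K * expR K * J%:R by rewrite !mulr_ge0 // ltW.
  by lra.
have hb2 : nm (w + J%:R *: B' w) <= (1 + K) * nm w.
  apply: le_trans (nmD spI _ _) _; rewrite (nmZ spI) (ger0_norm (ltW J1)) mulrDl mul1r lerD2l.
  apply: (@le_trans _ _ (J%:R * (K / (1 + J%:R) * nm w))).
    by rewrite ler_wpM2l ?(ltW J1).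
  rewrite mulrA ler_wpM2r // mulrCA ler_piMr // ler_pdivrMr // mul1r.
  by rewrite lerDr.
have hb3 : J%:R * nm (w + J%:R *: B' w) <= 8 * K ^+ 2 * (1 + K) * nm x.
  apply: le_trans (ler_wpM2l (ltW J1) hb2) _.
  apply: (@le_trans _ _ (2 * t * ((1 + K) * nm w))).
    by rewrite ler_wpM2r // mulr_ge0 ?addr_ge0.
  rewrite (_ : 2 * t * _ = 2 * (1 + K) * (t * nm w)); last ring.
  apply: le_trans (ler_wpM2l _ hzz) _; first by rewrite mulr_ge0 ?addr_ge0.
  by rewrite le_eqVlt; apply/orP; left; apply/eqP; ring.
apply: le_trans (lerD hb1 hb3) _; rewrite -mulrDl ler_wpM2r //.
have : 0 <= K * expR K by rewrite mulr_ge0.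
by lra.
Qed.

End Ladder.

(** * Bounded Euler orbits under logarithmic decay *)

(** Makes the p-series telescope. It rests on [ln (k / (k + 1)) <= - 1 / (k + 1)] and
    [exp (- u) <= 1 / (1 + u)]; the constant is [k g / (k + 1 + g)] at its worst value [k = 1]. *)
Lemma powR_step (R : realType) (g : R) (k : nat) : 0 < g -> (0 < k)%N ->
  k%:R `^ (- (1 + g)) * (g / (2 + g)) <= k%:R `^ (- g) - k.+1%:R `^ (- g).
Proof.
move=> g0 k0; have kR : (0 : R) < k%:R by rewrite ltr0n.
have kS : (0 : R) < k.+1%:R by rewrite ltr0n.
have k1 : (1 : R) <= k%:R by rewrite ler1n.
have -> : (k%:R : R) `^ (- (1 + g)) = k%:R `^ (- g) / k%:R.
  rewrite opprD addrC powRD ?(gt_eqF kR) ?implybT //.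
  by rewrite (powRN _ 1) powRr1 // ltW.
have -> : (k.+1%:R : R) `^ (- g) = k%:R `^ (- g) * expR (g * ln (k%:R / k.+1%:R)).
  rewrite /powR !gt_eqF // -expRD ln_div ?posrE //; congr expR; ring.
have p0 : 0 < (k%:R : R) `^ (- g) by rewrite powR_gt0.
rewrite -[X in _ <= X - _]mulr1 -mulrBr -mulrA ler_pM2l //.
set u := g / k.+1%:R; have u0 : 0 < u by rewrite divr_gt0.
have h1 : expR (g * ln (k%:R / k.+1%:R)) <= expR (- u).
  rewrite ler_expR /u -mulrN ler_pM2l //.
  have := @le_ln1Dx R (- k.+1%:R^-1).
  have -> : 1 + - k.+1%:R^-1 = k%:R / k.+1%:R :> R.
    by rewrite -natr1; field; rewrite natr1 gt_eqF.
  by apply; rewrite ltrN2 invf_lt1 ?ltr1n.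
have h2 : expR (- u) <= (1 + u)^-1.
  by rewrite expRN lef_pV2 ?posrE ?expR_gt0 ?expR_ge1Dx // ltr_pwDl // ltW.
have h3 : k%:R^-1 * (g / (2 + g)) <= 1 - (1 + u)^-1.
  have -> : 1 - (1 + u)^-1 = g / (k%:R + 1 + g).
    rewrite /u -natr1; field.
    by rewrite !gt_eqF //; lra.
  rewrite mulrCA ler_pM2l // -invfM lef_pV2 ?posrE ?mulr_gt0 ?addr_gt0 //; nra.
lra.
Qed.

Lemma powR_sum_bounded (R : realType) (b : R) : 1 < b ->
  exists G, forall n, \sum_(k < n) k.+1%:R `^ (- b) <= G.
Proof.
move=> b1; set g := b - 1; have g0 : 0 < g by rewrite subr_gt0.
have bg : b = 1 + g by rewrite /g; ring.
have c0 : 0 < g / (2 + g) by rewrite divr_gt0 // addr_gt0.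
exists ((2 + g) / g) => n.
suff : (\sum_(k < n) k.+1%:R `^ (- b)) * (g / (2 + g)) <= 1 - n.+1%:R `^ (- g).
  move=> h; have := powR_ge0 (n.+1%:R : R) (- g) => p0.
  rewrite -[(2 + g) / g]invf_div -[_^-1]mul1r ler_pdivlMr //.
  by apply: le_trans h _; lra.
elim: n => [|n IH]; first by rewrite big_ord0 mul0r powR1 subrr.
rewrite big_ord_recr /= mulrDl {2}bg.
have := powR_step g0 (ltn0Sn n); lra.
Qed.

Lemma sum_below (R : realType) (a h : R) m : 0 <= h -> 0 <= a ->
  \sum_(j < m) (if j%:R * h < a then h else 0) <= a + h.
Proof.
move=> h0 a0.
have le_mh n : \sum_(j < n) (if j%:R * h < a then h else 0) <= n%:R * h.
  elim: n => [|n IH]; first by rewrite big_ord0 mul0r.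
  rewrite big_ord_recr /= -natr1 mulrDl mul1r lerD //.
  by case: ifP.
elim: m => [|m IH]; first by rewrite big_ord0 addr_ge0.
rewrite big_ord_recr /=; case: ifP => [ma|_]; last by rewrite addr0.
by rewrite lerD2r (le_trans (le_mh m)) // ltW.
Qed.

(** Serves to choose the last shift: a ladder of [k] rungs costs a factor linear in [k], against a
    perturbation of size [16 ^- k]. *)
Lemma linear_over_exp_small (R : realType) (P Q e : R) n0 : 0 <= P -> 0 <= Q -> 0 < e ->
  exists2 k, (n0 <= k)%N & (P + Q * k%:R) * (16 ^+ k)^-1 <= e.
Proof.
move=> P0 Q0 e0.
have w0 : 0 < P + Q + 1 by rewrite ltr_wpDl ?addr_ge0.
have [k /(_ _ (leq_maxl k n0)) hk] := @expr_small R (1/2) _ ltac:(lra) ltac:(lra) (divr_gt0 e0 w0).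
exists (maxn k n0); first exact: leq_maxr.
set m := maxn k n0 in hk *.
have p2 : 0 < 2 ^+ m :> R by rewrite exprn_gt0.
have h1 : P + Q * m%:R <= (P + Q + 1) * 2 ^+ m.
  have : 1 <= 2 ^+ m :> R by rewrite exprn_ege1 // ler1n.
  have : m%:R <= 2 ^+ m :> R by rewrite -natrX ler_nat ltnW // ltn_expl.
  move: (2 ^+ m) (m%:R) => x y h1 h2; nra.
have e16 : 16 ^+ m = 2 ^+ m * 2 ^+ m * (2 ^+ m * 2 ^+ m) :> R.
  by rewrite -!exprMn; congr (_ ^+ _); ring.
rewrite ler_pdivrMr ?exprn_gt0 //; apply: le_trans h1 _.
move: hk; rewrite ler_pdivlMr // expr_div_n expr1n div1r mulrC ler_pdivrMr // => hk.
apply: le_trans (ler_wpM2r (ltW p2) hk) _; rewrite e16.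
have : 1 <= 2 ^+ m :> R by rewrite exprn_ege1 // ler1n.
move: (2 ^+ m) p2 => x p2 x1.
have x2 : x * x <= x * x * (x * x).
  have x1' : 1 <= x * x by nra.
  by rewrite ler_peMr // mulr_ge0 // ltW.
apply: le_trans (ler_wpM2l (ltW e0) x2).
by rewrite le_eqVlt; apply/orP; left; apply/eqP; ring.
Qed.

Section Core.
Variables (R : realType) (V : lmodType R) (sp : V -> V -> R).
Hypothesis spI : real_inner sp.
Hypothesis Vc : complete_inner sp.
Local Notation nm := (hnorm sp).
Let spE := spE spI.
Let nm_ge0 := nm_ge0 sp.
Variables (T : R -> V -> V) (K : R).
Hypothesis K1 : 1 <= K.
Hypothesis lT : forall t, 0 <= t -> linear (T t).
Hypothesis T0 : forall x, T 0 x = x.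
Hypothesis TD : forall s t x, 0 <= s -> 0 <= t -> T (s + t) x = T s (T t x).
Hypothesis TK : forall t x, 0 <= t -> nm (T t x) <= K * nm x.

Let K0 : 0 <= K. Proof. exact: le_trans ler01 K1. Qed.

Lemma semigroup_iter h n x : 0 <= h -> iter n (T h) x = T (n%:R * h) x.
Proof.
move=> h0; elim: n => [|n IH]; first by rewrite mul0r T0.
by rewrite iterS IH -TD ?mulr_ge0 // -natr1 mulrDl mul1r addrC.
Qed.

Lemma semigroup_pow h n x : 0 <= h -> nm (iter n (T h) x) <= K * nm x.
Proof. by move=> h0; rewrite semigroup_iter // TK // mulr_ge0. Qed.

Variables (B : V -> V) (b : R).
Hypotheses (b0 : 0 <= b) (Bb : forall x, nm (B x) <= b * nm x).

(** The defect in [A (B x) = x] when the generator is replaced by its difference quotient at [h]. *)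
Definition gen_err h x := h^-1 *: (T h (B x) - B x) - x.

Hypothesis BA : forall x e, 0 < e -> exists2 d, 0 < d &
  forall h, 0 < h -> h <= d -> nm (gen_err h x) <= e.

Variables (M beta t0 : R).
Hypotheses (beta1 : 1 < beta) (M0 : 0 <= M) (t01 : 1 < t0).
Hypothesis decay : forall t x, t0 <= t -> nm (T t (B x)) <= M / (ln t) `^ beta * nm x.

Let rate (k : nat) : R := M / (ln (4 ^+ k)) `^ beta.
Let r16 (k : nat) : R := (16 ^+ k)^-1.

Let r16_gt0 k : 0 < r16 k. Proof. by rewrite invr_gt0 exprn_gt0. Qed.

(** Time is cut at [4 ^+ k]. Before the cut only boundedness is used, and weights of at most [h] add
    up to about [4 ^+ k]; after it the decay applies, at its value at the cut, and the total weight
    is at most [16 ^+ k]. *)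
Lemma lyap_decay k h m y : t0 <= 4 ^+ k -> 0 < h -> h <= 1 ->
  lyap sp (T h) h (r16 k) m (B y) <=
  (K ^+ 2 * b ^+ 2 * (4 ^+ k + 1) + rate k ^+ 2 * 16 ^+ k) * nm y ^+ 2.
Proof.
move=> tk h0 h1; rewrite /lyap.
have a1 : 1 < 4 ^+ k :> R by rewrite (lt_le_trans t01).
have a0 : 0 < 4 ^+ k :> R by rewrite exprn_gt0.
have la : 0 < ln (4 ^+ k) :> R by rewrite ln_gt0.
have q0 := ratio_gt0 h0 (r16_gt0 k); have q1 := ratio_lt1 h0 (r16_gt0 k).
have rk0 : 0 <= rate k by rewrite divr_ge0 // powR_ge0.
pose S1 := \sum_(j < m) (if j%:R * h < 4 ^+ k then h else 0) * (K ^+ 2 * b ^+ 2 * nm y ^+ 2).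
pose S2 := \sum_(j < m) (h * ratio h (r16 k) ^+ j.*2.+1) * (rate k ^+ 2 * nm y ^+ 2).
apply: (@le_trans _ _ (S1 + S2)).
  rewrite -big_split /=; apply: ler_sum => j _.
  rewrite semigroup_iter ?(ltW h0) //.
  have w0 : 0 <= h * ratio h (r16 k) ^+ j.*2.+1.
    by rewrite mulr_ge0 ?exprn_ge0 ?(ltW h0) ?(ltW q0).
  have j0 : 0 <= j%:R * h by rewrite mulr_ge0 // ltW.
  case: ltP => jh.
    apply: ler_wpDr; first by rewrite mulr_ge0 // mulr_ge0 ?sqr_ge0.
    apply: ler_pM => //; rewrite ?sqr_ge0 //.
      by rewrite ler_piMr ?(ltW h0) // exprn_ile1 ?(ltW q0) ?(ltW q1).
    rewrite -!exprMn ler_sqr ?nnegrE ?mulr_ge0 ?nm_ge0 //.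
    apply: le_trans (TK _ j0) _; rewrite -mulrA ler_wpM2l //; exact: Bb.
  rewrite mul0r add0r ler_wpM2l // -exprMn.
  rewrite ler_sqr ?nnegrE ?nm_ge0 ?(mulr_ge0 rk0 (nm_ge0 _)) //.
  apply: le_trans (decay y (le_trans tk jh)) _.
  rewrite ler_wpM2r ?nm_ge0 // ler_wpM2l // lef_pV2 ?posrE ?powR_gt0 //; last first.
    by rewrite ln_gt0 // (lt_le_trans a1).
  apply: ge0_ler_powR; rewrite ?nnegrE ?(ltW la) ?(ltW (lt_trans ltr01 beta1)) //.
    by rewrite ln_ge0 // (le_trans (ltW a1)).
  by rewrite ler_ln ?posrE // (lt_le_trans a0).
rewrite mulrDl /S1 /S2 -!mulr_suml; apply: lerD.
  rewrite [K ^+ 2 * _ * _ * _]mulrAC [X in _ <= X]mulrC.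
  rewrite ler_wpM2r ?mulr_ge0 ?sqr_ge0 //.
  by apply: le_trans (sum_below _ (ltW h0) (ltW a0)) _; rewrite lerD2l.
have w0 : 0 <= rate k ^+ 2 * nm y ^+ 2 by rewrite mulr_ge0 // sqr_ge0.
rewrite [rate k ^+ 2 * 16 ^+ k]mulrC -[X in _ <= X]mulrA ler_wpM2r //.
by apply: le_trans (wgt_sum h0 m (r16_gt0 k)) _; rewrite invrK.
Qed.


Let step k : R := 15 * K * (2 * K * b * (2 ^+ k)^-1 + rate k).

(* Here [u = 2 ^ k], so that [16 ^ k = u ^+ 4] and [4 ^ k = u ^+ 2]. *)
Lemma ladder_step_bound (u L ny : R) : 1 <= u -> 0 <= L -> 0 <= ny ->
  16 * K ^+ 2 * (u^-1 ^+ 4 - (16 * u ^+ 4)^-1) ^+ 2 *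
    ((K ^+ 2 * b ^+ 2 * (u ^+ 2 + 1) + L ^+ 2 * u ^+ 4) * ny ^+ 2) / (16 * u ^+ 4)^-1 <=
  (15 * K * (2 * K * b * u^-1 + L) * ny) ^+ 2.
Proof.
move=> u1 L0 ny0; have u0 : 0 < u by rewrite (lt_le_trans ltr01).
have un : u != 0 by rewrite gt_eqF.
have -> : 16 * K ^+ 2 * (u^-1 ^+ 4 - (16 * u ^+ 4)^-1) ^+ 2 *
    ((K ^+ 2 * b ^+ 2 * (u ^+ 2 + 1) + L ^+ 2 * u ^+ 4) * ny ^+ 2) / (16 * u ^+ 4)^-1 =
  (15 * K * ny) ^+ 2 * (K ^+ 2 * b ^+ 2 * (u ^+ 2 + 1) / u ^+ 4 + L ^+ 2) by field.
have -> : (15 * K * (2 * K * b * u^-1 + L) * ny) ^+ 2 =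
  (15 * K * ny) ^+ 2 * (2 * K * b * u^-1 + L) ^+ 2 by ring.
rewrite ler_wpM2l ?sqr_ge0 //.
have h1 : K ^+ 2 * b ^+ 2 * (u ^+ 2 + 1) / u ^+ 4 <= (2 * K * b * u^-1) ^+ 2.
  have -> : (2 * K * b * u^-1) ^+ 2 = K ^+ 2 * b ^+ 2 * (4 * u ^+ 2) / u ^+ 4 by field.
  rewrite ler_wpM2r ?invr_ge0 ?exprn_ge0 ?(ltW u0) // ler_wpM2l //.
    by rewrite -exprMn sqr_ge0.
  have : 1 <= u ^+ 2 by rewrite exprn_ege1.
  by lra.
have : 0 <= 2 * K * b * u^-1 * L by rewrite !mulr_ge0 // invr_ge0 ltW.
by rewrite sqrrD; lra.
Qed.

(** Shift [1] is left in a single jump to [16 ^- k0], at a cost depending on [k0], because the decay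
    hypothesis says nothing before [t0]. From there each rung is [euler_diff], the energy of [B y]
    being taken at the larger shift through [lyap_decay]. *)
Lemma ladder_down h k0 j B1 Bj y n k : 0 < h -> h <= 1 -> t0 <= 4 ^+ k0 ->
  shifted_inverse sp (T h) K h 1 B1 ->
  shifted_inverse sp (T h) K h (r16 (k0 + j)) Bj -> 0 < k ->
  k * (K ^+ 2 * 16 ^+ (k0 + j)) <= 1 / 4 ->
  nm (iter n (euler k Bj) (B y)) <= nm (iter n (euler k B1) (B y)) +
    (4 * K ^+ 2 * b * 4 ^+ k0 + \sum_(i < j) step (k0 + i)) * nm y.
Proof.
move=> h0 h1 tk rB1 rBj k0' kj.
have lC := lT (ltW h0); have CK n' x := semigroup_pow n' x (ltW h0).
have kK x : 1 <= x -> k * (K ^+ 2 * x) <= 1 / 4 -> k * (K ^+ 2 / 1) <= 1 / 4.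
  move=> x1; apply: le_trans; rewrite divr1 ler_wpM2l ?(ltW k0') //.
  by rewrite ler_peMr ?sqr_ge0.
elim: j Bj rBj kj => [|j IH] Bj rBj kj.
  rewrite big_ord0 addr0 addn0 in rBj kj *.
  have kr : k * (K ^+ 2 / r16 k0) <= 1 / 4 by rewrite invrK.
  have k1 : k * (K ^+ 2 / 1) <= 1 / 4.
    by apply: kK kj; rewrite exprn_ege1 // ler1n.
  have FT m : lyap sp (T h) h 1 m (B y) <= (K * b * nm y) ^+ 2.
    apply: le_trans (lyap_le K1 h0 CK m (B y) ltr01) _.
    rewrite divr1 -exprMn ler_sqr ?nnegrE ?mulr_ge0 ?nm_ge0 //.
    by rewrite -mulrA ler_wpM2l.
  have := euler_diff spI Vc lC K1 h0 CK n ltr01 (r16_gt0 k0) rB1 rBj k0' k1 kr FT.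
  rewrite (nmBC spI) => hd.
  rewrite -[iter n (euler k Bj) _](subrK (iter n (euler k B1) (B y))) addrC.
  apply: le_trans (nmD spI _ _) _; rewrite lerD2l.
  rewrite -ler_sqr ?nnegrE ?nm_ge0 ?mulr_ge0 ?exprn_ge0 //.
  apply: le_trans hd _; rewrite invrK.
  have -> : (4 * K ^+ 2 * b * 4 ^+ k0 * nm y) ^+ 2 =
    16 * K ^+ 2 * 1 * (K * b * nm y) ^+ 2 * 16 ^+ k0.
    have -> : 16 ^+ k0 = 4 ^+ k0 ^+ 2 :> R.
      by rewrite exprAC; congr (_ ^+ _); ring.
    by move: (4 ^+ k0) => w; ring.
  rewrite ler_wpM2r ?exprn_ge0 // ler_wpM2r ?sqr_ge0 // ler_wpM2l ?mulr_ge0 ?sqr_ge0 //.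
  have ri : r16 k0 <= 1 by rewrite invf_le1 ?exprn_gt0 // exprn_ege1 // ler1n.
  by rewrite exprn_ile1 ?subr_ge0 // gerBl ltW.
have e16 : 16 ^+ (k0 + j.+1) = 16 * 16 ^+ (k0 + j) :> R by rewrite addnS exprS.
have p16 : 0 < 16 ^+ (k0 + j) :> R by rewrite exprn_gt0.
have [B' rB'] := shifted_inverse_exists spI Vc lC K1 h0 CK (r16_gt0 (k0 + j)).
have kj' : k * (K ^+ 2 * 16 ^+ (k0 + j)) <= 1 / 4.
  apply: le_trans kj; rewrite ler_wpM2l ?(ltW k0') // ler_wpM2l ?sqr_ge0 //.
  by rewrite e16; lra.
have kr : k * (K ^+ 2 / r16 (k0 + j.+1)) <= 1 / 4 by rewrite invrK.
have kr' : k * (K ^+ 2 / r16 (k0 + j)) <= 1 / 4 by rewrite invrK.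
have tj : t0 <= 4 ^+ (k0 + j).
  by apply: le_trans tk _; rewrite ler_weXn2l ?leq_addr // ler1n.
have {}IH := IH B' rB' kj'.
have := euler_diff spI Vc lC K1 h0 CK n (r16_gt0 (k0 + j)) (r16_gt0 (k0 + j.+1)) rB' rBj k0'
  kr' kr (fun m => lyap_decay m y tj h0 h1).
have rk0 i : 0 <= rate i by rewrite divr_ge0 // powR_ge0.
set d := nm _ => hd.
have {}hd : d <= step (k0 + j) * nm y.
  rewrite -ler_sqr ?nnegrE ?nm_ge0 //; last first.
    apply: mulr_ge0 => //; apply: mulr_ge0; first exact: mulr_ge0.
    apply: addr_ge0 => //; apply: mulr_ge0; last by rewrite invr_ge0 exprn_ge0.
    by apply: mulr_ge0 => //; exact: mulr_ge0.
  apply: le_trans hd _.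
  have u1 : 1 <= 2 ^+ (k0 + j) :> R by rewrite exprn_ege1 // ler1n.
  have := ladder_step_bound u1 (rk0 (k0 + j)%N) (nm_ge0 y).
  rewrite /r16 e16.
  have -> : 16 ^+ (k0 + j) = 2 ^+ (k0 + j) ^+ 4 :> R.
    by rewrite exprAC; congr (_ ^+ _); ring.
  have -> : 4 ^+ (k0 + j) = 2 ^+ (k0 + j) ^+ 2 :> R.
    by rewrite exprAC; congr (_ ^+ _); ring.
  by rewrite exprVn.
rewrite -[iter n _ _](subrK (iter n (euler k B') (B y))).
apply: le_trans (nmD spI _ _) _; rewrite (nmBC spI).
apply: le_trans (lerD hd IH) _.
by rewrite big_ord_recr /=; lra.
Qed.

Lemma rateE k : (0 < k)%N -> rate k = M / (ln 4) `^ beta * k%:R `^ (- beta).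
Proof.
move=> k0; rewrite /rate lnXn // -[_ *+ k]mulr_natl.
by rewrite powRM ?ler0n ?ln_ge0 ?ler1n // powRN invfM [_^-1 * _]mulrC mulrA.
Qed.

(** A geometric series plus the series of [k ^ - beta], which converges as [beta > 1]; positivity of
    [k0] gives [i.+1 <= k0 + i]. *)
Lemma step_sum_bounded k0 : (0 < k0)%N ->
  exists2 G, 0 <= G & forall j, \sum_(i < j) step (k0 + i) <= G.
Proof.
move=> k00; have [G GP] := powR_sum_bounded beta1.
have [c c0 cE] : exists2 c, 0 <= c & forall k, (0 < k)%N -> rate k = c * k%:R `^ (- beta).
  by exists (M / (ln 4) `^ beta); [rewrite divr_ge0 // powR_ge0 | exact: rateE].
have P j : \sum_(i < j) step (k0 + i) <= 15 * K * (2 * K * b * 2 + c * G).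
  have p1 i : (2 ^+ (k0 + i))^-1 <= 2^-1 ^+ i :> R.
    by rewrite exprVn lef_pV2 ?posrE ?exprn_gt0 // ler_weXn2l ?leq_addl // ler1n.
  have p2 i : rate (k0 + i) <= c * i.+1%:R `^ (- beta).
    rewrite cE ?addn_gt0 ?k00 // ler_wpM2l //.
    rewrite !powRN lef_pV2 ?posrE ?powR_gt0 ?ltr0n ?addn_gt0 ?k00 //.
    apply: ge0_ler_powR; rewrite ?nnegrE ?ler0n ?(ltW (lt_trans ltr01 beta1)) //.
    by rewrite ler_nat -add1n leq_add2r.
  apply: (@le_trans _ _ (\sum_(i < j)
      15 * K * (2 * K * b * 2^-1 ^+ i + c * i.+1%:R `^ (- beta)))).
    apply: ler_sum => i _; rewrite /step ler_wpM2l ?mulr_ge0 //.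
    by rewrite lerD // ler_wpM2l ?mulr_ge0.
  rewrite -mulr_sumr ler_wpM2l ?mulr_ge0 // big_split /= -!mulr_sumr lerD //.
    rewrite ler_wpM2l ?mulr_ge0 //.
    have := @geom_le R 2^-1 j ltac:(lra) ltac:(lra).
    by have -> : (1 - 2^-1)^-1 = 2 :> R by field.
  by rewrite ler_wpM2l // GP.
by exists (15 * K * (2 * K * b * 2 + c * G)) => //; have := P 0%N; rewrite big_ord0.
Qed.

(** The defect vanishes only pointwise as [h] tends to [0], but a single [h] has to serve a whole
    finite Euler orbit. *)
Lemma gen_err_family (u : nat -> V) N e : 0 < e -> exists2 d, 0 < d &
  forall h, 0 < h -> h <= d -> forall i, (i < N)%N -> nm (gen_err h (u i)) <= e.
Proof.
move=> e0; elim: N => [|N [d d0 dP]]; first by exists 1.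
have [d' d'0 d'P] := BA (u N) e0; exists (Num.min d d'); first by rewrite lt_min d0.
move=> h h0; rewrite le_min => /andP[hd hd'] i; rewrite ltnS leq_eqVlt => /orP[/eqP->|].
  exact: d'P.
exact: dP.
Qed.

Lemma shifted_inverse_gen h r Br w : 0 < h ->
  shifted_inverse sp (T h) K h r Br ->
  Br (gen_err h w) = r *: Br (B w) + B w - Br w.
Proof.
move=> h0 [lBr _ BrC _]; rewrite /gen_err !(mapB lBr, mapZ lBr) BrC.
apply: (sp_inj spI) => z; rewrite !spE.
by field; rewrite gt_eqF.
Qed.

(** One use of the resolvent identity leaves [r *: Br (B w)], which is merely bounded, as [Br] may
    have norm [K / r]. A second use, at [B w], replaces [Br (B w)] by vectors bounded uniformly in
    [r], so the factor [r] survives. The defects have to be of order [r ^+ 2] because [Br] costs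
    [1 / r]. *)
Lemma shifted_inverse_near h r Br w : 0 < h -> 0 < r -> r <= 1 ->
  shifted_inverse sp (T h) K h r Br ->
  nm (gen_err h w) <= r ^+ 2 -> nm (gen_err h (B w)) <= r ^+ 2 ->
  nm (B w - Br w) <= r * (2 * K + (1 + K) * (b ^+ 2 * nm w)).
Proof.
move=> h0 r0 r1 rBr e1 e2; have [lBr _ _ BrK] := rBr.
have s1 := shifted_inverse_gen w h0 rBr.
have s2 := shifted_inverse_gen (B w) h0 rBr.
have bound v : nm v <= r ^+ 2 -> nm (Br v) <= K * r.
  move=> hv; apply: le_trans (BrK v) _.
  apply: le_trans (ler_wpM2l _ hv) _; first by rewrite divr_ge0 // ltW.
  by rewrite le_eqVlt; apply/orP; left; apply/eqP; field; rewrite gt_eqF.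
have hBB : nm (B (B w)) <= b ^+ 2 * nm w.
  by apply: le_trans (Bb _) _; rewrite expr2 -mulrA ler_wpM2l.
have h3 : r * nm (Br (B (B w))) <= K * (b ^+ 2 * nm w).
  apply: le_trans (ler_wpM2l (ltW r0) (BrK _)) _.
  rewrite (_ : r * (K / r * _) = K * nm (B (B w))); last by field; rewrite gt_eqF.
  by rewrite ler_wpM2l.
have -> : B w - Br w = Br (gen_err h w) - r *: (B (B w) - Br (gen_err h (B w)) + r *: Br (B (B w))).
  apply: (sp_inj spI) => z; rewrite s1 s2 !spE; ring.
apply: le_trans (nmB spI _ _) _; rewrite (nmZ spI) (ger0_norm (ltW r0)).
have h4 : nm (B (B w) - Br (gen_err h (B w)) + r *: Br (B (B w))) <=
    b ^+ 2 * nm w + K * r + K * (b ^+ 2 * nm w).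
  apply: le_trans (nmD spI _ _) _; rewrite (nmZ spI) (ger0_norm (ltW r0)) lerD //.
  apply: le_trans (nmB spI _ _) _; rewrite lerD //; exact: bound.
have h5 : K * r <= K by rewrite ler_piMr.
have := ler_wpM2l (ltW r0) h4; have := bound _ e1.
have := ler_wpM2l (ltW r0) h5.
by lra.
Qed.


Lemma nat_above (x : R) : exists n : nat, x <= n%:R.
Proof.
exists (Num.bound `|x|); apply: le_trans (ler_norm x) _.
by apply: ltW; apply: archi_boundP.
Qed.

(** [G] is uniform in [t], whereas [N] depends on [t], [y] and [e]; the lower bound [n0] lets [N] be
    large enough for the Euler product to be close to the exponential. *)
Theorem euler_orbit_bound : exists2 G, 0 <= G & forall t y e n0, 0 <= t -> 0 < e ->
  exists N, [/\ (n0 <= N)%N, (0 < N)%N &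
    nm (iter N (euler (t / N%:R) B) (B y)) <= G * nm y + e].
Proof.
have [k0 k00 tk] : exists2 k0, (0 < k0)%N & t0 <= 4 ^+ k0.
  have [n hn] := nat_above t0; exists n.+1 => //.
  by apply: le_trans hn _; rewrite -natrX ler_nat ltnW // (ltn_trans (ltnSn n)) // ltn_expl.
have [S S0 SP] := step_sum_bounded k00.
set C1 := 15 * K ^+ 3 + 3 * K * expR K + 8 * K ^+ 2 * (1 + K).
have C10 : 0 <= C1.
  by rewrite /C1 !addr_ge0 // ?mulr_ge0 ?exprn_ge0 ?addr_ge0 ?expR_ge0.
have D0 : 0 <= 4 * K ^+ 2 * b * 4 ^+ k0 by rewrite !mulr_ge0 ?exprn_ge0.
(* The summands account for the bound at shift [1], the descent to the last shift, and the case
   [t = 0], which is separate because the Euler step must be positive. *)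
exists (C1 * (1 + b) + (4 * K ^+ 2 * b * 4 ^+ k0 + S) + b).
  by rewrite !addr_ge0 // mulr_ge0 // addr_ge0.
move=> t y e n0; rewrite le_eqVlt => /orP[/eqP <-|tp] e0.
  exists n0.+1; split=> //; rewrite mul0r.
  have -> x n : iter n (euler 0 B) x = x.
    by elim: n => //= n ->; rewrite /euler scale0r addr0.
  apply: le_trans (Bb y) _; apply: ler_wpDr; first exact: ltW.
  by rewrite ler_wpM2r ?nm_ge0 // lerDr !addr_ge0 // mulr_ge0 // addr_ge0.
have [Jt hJt] : exists Jt : nat, t <= 16 ^+ Jt.
  have [n hn] := nat_above t; exists n; apply: le_trans hn _.
  by rewrite -natrX ler_nat ltnW // ltn_expl.
have ny := nm_ge0 y.
set om := expR (t * b) * (b * nm y); have om0 : 0 <= om.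
  by rewrite mulr_ge0 ?expR_ge0 // mulr_ge0.
set Z := 2 * K + (1 + K) * (b ^+ 2 * om).
have Z0 : 0 <= Z by rewrite addr_ge0 ?mulr_ge0 ?addr_ge0 ?sqr_ge0.
have P0 : 0 <= t * Z * (15 * K ^+ 2 * Jt%:R + expR K).
  by rewrite !mulr_ge0 ?(ltW tp) // addr_ge0 ?expR_ge0 // !mulr_ge0.
have Q0 : 0 <= t * Z * (15 * K ^+ 2) by rewrite !mulr_ge0 ?(ltW tp).
have e2 : 0 < e / 2 by rewrite divr_gt0.
(* The constants are those of [diff] below, where [ladder_up] climbs [Jt + k] rungs: from [16 ^- k]
   up to a shift of at least [t]. *)
have [k kk0 hk] := linear_over_exp_small k0 P0 Q0 e2.
have [n1 hn1] := nat_above (4 * t * K ^+ 2 * 16 ^+ k).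
pose N := (maxn n0 n1).+1; exists N; split=> //; first by rewrite /N leqW // leq_maxl.
have Np : 0 < N%:R :> R by rewrite ltr0n.
set ka := t / N%:R; have ka0 : 0 < ka by rewrite divr_gt0.
have Nka : N%:R * ka = t by rewrite mulrC divfK // gt_eqF.
have kak : ka * (K ^+ 2 * 16 ^+ k) <= 1 / 4.
  have : 4 * t * K ^+ 2 * 16 ^+ k <= N%:R.
    by apply: le_trans hn1 _; rewrite ler_nat /N leqW // leq_maxr.
  rewrite (_ : ka * _ = t * K ^+ 2 * 16 ^+ k / N%:R); last by rewrite /ka mulrAC !mulrA.
  by rewrite ler_pdivrMr //; move: (16 ^+ k) => v; lra.
have rp := r16_gt0 k.
have r1 : r16 k <= 1 by rewrite invf_le1 ?exprn_gt0 // exprn_ege1 // ler1n.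
pose w i := iter i (euler ka B) (B y).
have rr0 : 0 < r16 k ^+ 2 by rewrite exprn_gt0.
have c1 : 0 < C1 + 1 by rewrite ltr_wpDl.
have [d1 d10 dP1] := gen_err_family w N rr0.
have [d2 d20 dP2] := gen_err_family (fun i => B (w i)) N rr0.
have [d3 d30 dP3] := BA y (divr_gt0 e2 c1).
pose h := Num.min (Num.min d1 d2) (Num.min d3 1).
have h0 : 0 < h by rewrite !lt_min d10 d20 d30 ltr01.
have [hd1 hd2 hd3 h1] : [/\ h <= d1, h <= d2, h <= d3 & h <= 1].
  by rewrite /h !ge_min !lexx !orbT.
have lC := lT (ltW h0); have CK n' x := semigroup_pow n' x (ltW h0).
have [B1 rB1] := shifted_inverse_exists spI Vc lC K1 h0 CK ltr01.
have [Bk rBk] := shifted_inverse_exists spI Vc lC K1 h0 CK rp.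
have [lBk _ _ _] := rBk; have lWk := linear_step ka lBk.
have kakr : ka * (K ^+ 2 / r16 k) <= 1 / 4 by rewrite invrK.
set L := 15 * K ^+ 2 * (Jt + k)%:R + expR K.
have L0 : 0 <= L by rewrite addr_ge0 ?expR_ge0 // !mulr_ge0.
(* Exchange of [B] for [Bk]. The orbit of [B] is bounded crudely by [om], exponential in [t]; this
   is affordable because the shift is chosen after [t]. *)
have diff : nm (iter N (euler ka B) (B y) - iter N (euler ka Bk) (B y)) <= e / 2.
  rewrite (iter_diff _ _ _ lWk); apply: le_trans (nm_sum spI _ _ _) _.
  apply: (@le_trans _ _ (\sum_(i < N) L * (ka * (r16 k * Z)))).
    apply: ler_sum => i _; rewrite -/(w i).
    have iN : i%:R * ka <= t.
      by rewrite -Nka ler_wpM2r ?(ltW ka0) // ler_nat ltnW.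
    have wi : nm (w i) <= om.
      apply: le_trans (euler_pow_bound spI i (B y) (ltW ka0) b0 Bb) _.
      by apply: ler_pM; rewrite ?expR_ge0 ?nm_ge0 // ler_expR ler_wpM2r.
    apply: le_trans (ladder_up spI Vc lC K1 h0 CK (J := Jt + k) _ rp rBk ka0 kakr _) _.
      rewrite exprD mulfK ?expf_neq0 //.
      apply: le_trans hJt; rewrite -Nka ler_wpM2r ?(ltW ka0) // ler_nat leq_subr //.
    rewrite -/L ler_wpM2l //.
    have -> : euler ka B (w i) - euler ka Bk (w i) = ka *: (B (w i) - Bk (w i)).
      by rewrite /euler opprD addrACA subrr add0r scalerBr.
    rewrite (nmZ spI) (ger0_norm (ltW ka0)) ler_wpM2l ?(ltW ka0) //.
    apply: le_trans (shifted_inverse_near h0 rp r1 rBk (dP1 _ h0 hd1 _ _) (dP2 _ h0 hd2 _ _)) _ => //.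
    rewrite ler_wpM2l ?(ltW rp) // lerD2l ler_wpM2l ?addr_ge0 //.
    by rewrite ler_wpM2l ?sqr_ge0.
  rewrite sumr_const card_ord -[X in X <= _]mulr_natl.
  rewrite (_ : _ * (L * _) = N%:R * ka * Z * L * r16 k); last ring.
  rewrite Nka; apply: le_trans hk.
  by rewrite le_eqVlt; apply/orP; left; apply/eqP; rewrite /L natrD /r16; ring.
have [j kj] : exists j, k = (k0 + j)%N by exists (k - k0)%N; rewrite subnKC.
have down : nm (iter N (euler ka Bk) (B y)) <= nm (iter N (euler ka B1) (B y)) +
    (4 * K ^+ 2 * b * 4 ^+ k0 + S) * nm y.
  have rBk' : shifted_inverse sp (T h) K h (r16 (k0 + j)) Bk by rewrite -kj.
  rewrite kj in kak; apply: le_trans (ladder_down y N h0 h1 tk rB1 rBk' ka0 kak) _.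
  by rewrite lerD2l ler_wpM2r // lerD2l.
have [lB1 _ BC1 _] := rB1.
(* A preimage of [B y] under [B1], as [euler_inverse_bound] requires; by [BA] it is close to
   [y - B y]. *)
pose z := h^-1 *: (T h (B y) - B y) - B y.
have zE : B1 z = B y.
  rewrite /z !(mapB lB1, mapZ lB1) BC1 mul1r; apply: (sp_inj spI) => v; rewrite !spE.
  by field; rewrite gt_eqF.
have zn : nm z <= (1 + b) * nm y + e / 2 / (C1 + 1).
  have -> : z = gen_err h y + (y - B y) by rewrite /z /gen_err addrA subrK.
  apply: le_trans (nmD spI _ _) _; rewrite addrC lerD ?dP3 //.
  by apply: le_trans (nmB spI _ _) _; rewrite mulrDl mul1r lerD2l.
have ka1 : ka * K ^+ 2 <= 1 / 4.
  apply: le_trans kak; rewrite ler_wpM2l ?(ltW ka0) // ler_peMr ?sqr_ge0 //.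
  by rewrite exprn_ege1 // ler1n.
have top : nm (iter N (euler ka B1) (B y)) <= C1 * (1 + b) * nm y + e / 2.
  rewrite -zE; apply: le_trans (euler_inverse_bound spI Vc lC K1 h0 CK z N rB1 ka0 ka1) _.
  apply: le_trans (ler_wpM2l C10 zn) _; rewrite mulrDr mulrA lerD2l.
  by rewrite mulrA ler_pdivrMr // mulrC ler_pM2l // lerDl.
rewrite -[iter N _ _](subrK (iter N (euler ka Bk) (B y))).
apply: le_trans (nmD spI _ _) _; have := mulr_ge0 b0 ny.
by lra.
Qed.

End Core.

(** * Generators and their inverses *)

Section Generator.
Variables (R : realType) (V : lmodType R) (sp : V -> V -> R).
Hypothesis spI : real_inner sp.
Hypothesis Vc : complete_inner sp.
Local Notation nm := (hnorm sp).
Let spE := spE spI.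
Let nm_ge0 := nm_ge0 sp.

Definition strong_at0 (T : R -> V -> V) := forall x e, 0 < e ->
  exists2 d, 0 < d & forall h, 0 < h -> h <= d -> nm (T h x - x) <= e.

(** The graph of the generator, kept as a relation so that neither a domain nor a choice of value is
    involved. *)
Definition gen_rel (T : R -> V -> V) x y := forall e, 0 < e ->
  exists2 d, 0 < d & forall h, 0 < h -> h <= d -> nm (h^-1 *: (T h x - x) - y) <= e.

Definition rescale (c : R) (T : R -> V -> V) s x := expR (c * s) *: T s x.

Lemma gen_rel_unique T x y y' : gen_rel T x y -> gen_rel T x y' -> y = y'.
Proof.
move=> h1 h2; apply: (nm_small_eq spI) => e e0.
have e2 : 0 < e / 2 by rewrite divr_gt0.
have [d d0 dP] := h1 _ e2; have [d' d'0 d'P] := h2 _ e2.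
have m0 : 0 < Num.min d d' by rewrite lt_min d0.
have := dP _ m0; have := d'P _ m0; rewrite !ge_min !lexx orbT => /(_ isT) a /(_ isT) b.
apply: le_trans (nm_tri spI ((Num.min d d')^-1 *: (T (Num.min d d') x - x)) _ _) _.
by rewrite (nmBC spI y); lra.
Qed.

Lemma gen_rel_linear T a x x' y y' : (forall h, 0 < h -> linear (T h)) ->
  gen_rel T x y -> gen_rel T x' y' -> gen_rel T (a *: x + x') (a *: y + y').
Proof.
move=> lT h1 h2 e e0.
have a0 : 0 < `|a| + 1 by rewrite ltr_wpDl.
have e2 : 0 < e / 2 by rewrite divr_gt0.
have [d d0 dP] := h1 _ (divr_gt0 e2 a0); have [d' d'0 d'P] := h2 _ e2.
exists (Num.min d d'); first by rewrite lt_min d0.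
move=> h h0; rewrite le_min => /andP[hd hd'].
have {}dP := dP _ h0 hd; have {}d'P := d'P _ h0 hd'.
have -> : h^-1 *: (T h (a *: x + x') - (a *: x + x')) - (a *: y + y') =
    a *: (h^-1 *: (T h x - x) - y) + (h^-1 *: (T h x' - x') - y').
  by apply: (sp_inj spI) => z; rewrite (lT _ h0) !spE; ring.
apply: le_trans (nmD spI _ _) _; rewrite (nmZ spI).
have : `|a| * nm (h^-1 *: (T h x - x) - y) <= e / 2.
  apply: le_trans (ler_wpM2l (normr_ge0 a) dP) _.
  by rewrite mulrA ler_pdivrMr // mulrC ler_pM2l // lerDl.
by lra.
Qed.

Lemma expR_sub1_small (c e : R) : 0 < e -> exists2 d, 0 < d &
  forall h, 0 < h -> h <= d ->
    `|expR (c * h) - 1| <= e /\ `|h^-1 * (expR (c * h) - 1) - c| <= e.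
Proof.
move=> e0; set u := `|c| + 1; have u0 : 0 < u by rewrite ltr_wpDl.
have u1 : 1 <= u by rewrite lerDr.
have cu : `|c| <= u by rewrite lerDl.
exists (Num.min (1 / (2 * u)) (e / (2 * u ^+ 2))).
  by rewrite lt_min !divr_gt0 // ?mulr_gt0 // exprn_gt0.
move=> h h0; rewrite le_min ler_pdivlMr ?mulr_gt0 // ler_pdivlMr ?mulr_gt0 ?exprn_gt0 //.
move=> /andP[h1 h2].
set x := c * h.
have xu : `|x| <= u * h by rewrite normrM (ger0_norm (ltW h0)) ler_wpM2r // ltW.
have /andP[x1 x2] : - (u * h) <= x <= u * h by rewrite -ler_norml.
have l1 : 1 + x <= expR x := expR_ge1Dx x.
have l2 : expR x - 1 - x <= 2 * x ^+ 2.
  have p : 0 < 1 - x by lra.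
  have : expR x <= (1 - x)^-1.
    rewrite -[x in expR x]opprK expRN lef_pV2 ?posrE ?expR_gt0 //.
    exact: expR_ge1Dx.
  have : (1 - x)^-1 <= 1 + x + 2 * x ^+ 2.
    rewrite -[_^-1]div1r ler_pdivrMr //.
    have : 0 <= x ^+ 2 * (1 - 2 * x) by rewrite mulr_ge0 ?sqr_ge0 //; lra.
    by lra.
  by lra.
have x2u : x ^+ 2 <= (u * h) ^+ 2 by rewrite -real_normK ?num_real // ler_sqr ?nnegrE ?normr_ge0 // mulr_ge0 // ltW.
have uh0 : 0 <= u * h by rewrite mulr_ge0 // ltW.
have uh2 : u * h * (2 * (u * h)) <= u * h * 1 by rewrite ler_wpM2l //; lra.
have uuh : u * h * 2 <= e.
  apply: le_trans h2; rewrite [h * _]mulrC [u * h * 2]mulrAC ler_pM2r //.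
  by rewrite [u * 2]mulrC ler_pM2l // expr2 ler_pMr.
split.
  by rewrite ler_norml; apply/andP; split; lra.
have -> : h^-1 * (expR x - 1) - c = h^-1 * (expR x - 1 - x).
  by rewrite /x; field; rewrite gt_eqF.
rewrite normrM ger0_norm ?invr_ge0 ?(ltW h0) // ger0_norm; last by lra.
rewrite mulrC ler_pdivrMr //; apply: le_trans l2 _.
have h3 := ler_wpM2r (ltW h0) h2.
by move: x2u; rewrite exprMn => x2u; lra.
Qed.

Lemma gen_rel_rescale c T x y : gen_rel T x y -> gen_rel (rescale c T) x (y + c *: x).
Proof.
move=> h1 e e0; set w := 2 + nm x + nm y.
have w0 : 0 < w by rewrite /w -addrA ltr_wpDr ?addr_ge0 ?nm_ge0.
have ew : 0 < Num.min 1 (e / w) by rewrite lt_min ltr01 divr_gt0.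
have [d d0 dP] := h1 _ (divr_gt0 e0 w0).
have [d' d'0 d'P] := expR_sub1_small c ew.
exists (Num.min d d'); first by rewrite lt_min d0.
move=> h h0; rewrite le_min => /andP[hd hd'].
have {}dP := dP _ h0 hd; have [] := d'P _ h0 hd'.
rewrite !le_min => /andP[a1 a2] /andP[_ b2].
have -> : h^-1 *: (rescale c T h x - x) - (y + c *: x) =
  expR (c * h) *: (h^-1 *: (T h x - x) - y) + ((expR (c * h) - 1) *: y +
   (h^-1 * (expR (c * h) - 1) - c) *: x).
  by apply: (sp_inj spI) => z; rewrite /rescale !spE; ring.
apply: le_trans (nmD spI _ _) _.
apply: le_trans (lerD (lexx _) (nmD spI _ _)) _; rewrite !(nmZ spI).
have e1 : `|expR (c * h)| <= 2.
  rewrite -[expR _](subrK 1); apply: le_trans (ler_normD _ _) _.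
  by rewrite normr1; lra.
have f1 := ler_pM (normr_ge0 _) (nm_ge0 _) e1 dP.
have f2 := ler_wpM2r (nm_ge0 y) a2; have f3 := ler_wpM2r (nm_ge0 x) b2.
have : w * (e / w) = e by rewrite mulrC divfK // gt_eqF.
by rewrite {1}/w; lra.
Qed.

Lemma rescaleK c T s x : rescale (- c) (rescale c T) s x = T s x.
Proof. by rewrite /rescale scalerA -expRD mulNr addNr expR0 scale1r. Qed.

Lemma gen_rel_ext T T' x y : (forall s x, T s x = T' s x) -> gen_rel T x y -> gen_rel T' x y.
Proof.
by move=> TT' h e /h[d d0 dP]; exists d => // s s0 /(dP _ s0); rewrite TT'.
Qed.

Section Semigroup.
Variables (T : R -> V -> V) (K : R).
Hypothesis K1 : 1 <= K.
Hypothesis lT : forall t, 0 <= t -> linear (T t).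
Hypothesis T0 : forall x, T 0 x = x.
Hypothesis TD : forall s t x, 0 <= s -> 0 <= t -> T (s + t) x = T s (T t x).

Let K0 : 0 <= K. Proof. exact: le_trans ler01 K1. Qed.

Lemma iter_sub_sum (L : V -> V) n x : linear L ->
  iter n L x - x = \sum_(i < n) iter i L (L x - x).
Proof.
move=> lL; elim: n => [|n IH]; first by rewrite big_ord0 subrr.
by rewrite big_ord_recr /= -IH (mapB (linear_iter n lL)) -iterSr addrC addrA subrK.
Qed.

(** Stands for the integral of [T s y] over [[0, t]]: the increments over steps [h = t / n.+1] are
    [h] times vectors close to [y], carried along by powers of [T h], which cost at most [K]. *)
Lemma gen_rel_orbit x y t : (forall t x, 0 <= t -> nm (T t x) <= K * nm x) ->
  0 <= t -> gen_rel T x y -> nm (T t x - x) <= K * t * nm y.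
Proof.
move=> TK t0 g; have [->|tn] := eqVneq t 0.
  by rewrite T0 subrr (nm0 spI) mulr0 mul0r.
have tp : 0 < t by rewrite lt_def tn.
apply/ler_addgt0Pl => e e0.
have Kt : 0 < K * t by rewrite mulr_gt0 // (lt_le_trans ltr01).
have [d d0 dP] := g _ (divr_gt0 e0 Kt).
have [n hn] := nat_above (t / d).
have N0 : 0 < n.+1%:R :> R by [].
set h := t / n.+1%:R; have h0 : 0 < h by rewrite divr_gt0.
have hd : h <= d.
  rewrite ler_pdivrMr // mulrC -ler_pdivrMr //; apply: le_trans hn _.
  by rewrite ler_nat.
have {}dP := dP h h0 hd.
have c1 : nm (T h x - x) <= h * (nm y + e / (K * t)).
  have -> : T h x - x = h *: ((h^-1 *: (T h x - x) - y) + y).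
    by rewrite subrK scalerA mulfV ?gt_eqF // scale1r.
  rewrite (nmZ spI) (ger0_norm (ltW h0)) ler_wpM2l ?(ltW h0) //.
  by apply: le_trans (nmD spI _ _) _; rewrite addrC lerD2l.
have tE : T t x = iter n.+1 (T h) x.
  by rewrite (semigroup_iter T0 TD) ?(ltW h0) // mulrC divfK // gt_eqF.
rewrite tE (iter_sub_sum _ _ (lT (ltW h0))); apply: le_trans (nm_sum spI _ _ _) _.
apply: (@le_trans _ _ (\sum_(i < n.+1) K * (h * (nm y + e / (K * t))))).
  apply: ler_sum => i _; apply: le_trans (semigroup_pow T0 TD TK _ _ (ltW h0)) _.
  by rewrite ler_wpM2l.
rewrite sumr_const card_ord -[X in X <= _]mulr_natl.
rewrite le_eqVlt; apply/orP; left; apply/eqP; rewrite /h.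
have Kn : K != 0 by rewrite gt_eqF // (lt_le_trans ltr01).
have := lt0r_neq0 N0; move: (n.+1%:R : R) => N Nn.
by field; rewrite tn Kn Nn.
Qed.


End Semigroup.

(** * Exponentially stable semigroups: surjectivity of the generator *)

Section ExponentiallyStable.
Variables (T : R -> V -> V) (K r : R).
Hypothesis K1 : 1 <= K.
Hypothesis r0 : 0 < r.
Hypothesis lT : forall t, 0 <= t -> linear (T t).
Hypothesis T0 : forall x, T 0 x = x.
Hypothesis TD : forall s t x, 0 <= s -> 0 <= t -> T (s + t) x = T s (T t x).
Hypothesis TS : strong_at0 T.
Hypothesis TK : forall t x, 0 <= t -> nm (T t x) <= K * expR (- r * t) * nm x.

Let K0 : 0 <= K. Proof. exact: le_trans ler01 K1. Qed.

Let TK1 t x : 0 <= t -> nm (T t x) <= K * nm x.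
Proof.
move=> t0; apply: le_trans (TK x t0) _; rewrite ler_wpM2r ?nm_ge0 // ler_piMr //.
by rewrite -expR0 ler_expR mulNr oppr_le0 mulr_ge0 // ltW.
Qed.

(** The factor [h] compensates the blow-up of the inverse: [exp (- r h) <= 1 / (1 + r h)] gives
    [h / (1 - exp (- r h)) <= 1 / r + h]. *)
Lemma one_sub_inverse h : 0 < h -> exists g : V -> V,
  [/\ linear g, (forall x, g x - T h (g x) = x), (forall x, g (x - T h x) = x) &
      (forall x, h * nm (g x) <= K * (r^-1 + h) * nm x)].
Proof.
move=> h0; have rh : 0 < r * h by rewrite mulr_gt0.
have q1 : expR (- r * h) < 1 by rewrite -expR0 ltr_expR mulNr oppr_lt0.
have LK n x : nm (iter n (T h) x) <= K * expR (- r * h) ^+ n * nm x.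
  rewrite (semigroup_iter T0 TD) ?(ltW h0) // -expRM_natl.
  apply: le_trans (TK _ _) _; first by rewrite mulr_ge0 // ltW.
  by rewrite mulrCA.
have [g [lg gR gL gK]] := neumann spI Vc (lT (ltW h0)) (expR_ge0 _) q1 K0 LK.
exists g; split=> // x; apply: le_trans (ler_wpM2l (ltW h0) (gK x)) _.
rewrite mulrA ler_wpM2r ?nm_ge0 // mulrCA ler_wpM2l //.
rewrite ler_pdivrMr ?subr_gt0 //.
have h1 : expR (- r * h) <= (1 + r * h)^-1.
  by rewrite mulNr expRN lef_pV2 ?posrE ?expR_gt0 ?expR_ge1Dx // ltr_pwDl // ltW.
have e1 : h = (r^-1 + h) * (1 - (1 + r * h)^-1).
  by field; rewrite !gt_eqF //; lra.
rewrite {1}e1 ler_wpM2l ?lerD2l ?lerN2 // addr_ge0 ?invr_ge0 // ltW //.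
Qed.

Let dy n : R := (2 ^+ n)^-1.

Let dy_gt0 n : 0 < dy n. Proof. by rewrite invr_gt0 exprn_gt0. Qed.

Let dyD n j : dy n = (2 ^ j)%:R * dy (n + j).
Proof. by rewrite /dy exprD natrX invfM mulrCA divff ?mulr1 // expf_neq0. Qed.

Lemma dy_small e : 0 < e -> exists N, forall n, (N <= n)%N -> dy n <= e.
Proof.
move=> e0; have [N NP] := @expr_small R 2^-1 e ltac:(lra) ltac:(lra) e0.
by exists N => n /NP; rewrite exprVn.
Qed.

Lemma sum_iter_near L h n x e : linear L -> (forall i, L i = T h i) -> 0 < h ->
  (forall s, 0 < s -> s <= n%:R * h -> nm (T s x - x) <= e) -> 0 <= e ->
  nm (\sum_(i < n) iter i L x - n%:R *: x) <= n%:R * e.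
Proof.
move=> lL LT h0 Tx e0; have -> : n%:R *: x = \sum_(i < n) x.
  by rewrite sumr_const card_ord scaler_nat.
rewrite -sumrB; apply: le_trans (nm_sum spI _ _ _) _.
have -> : n%:R * e = \sum_(i < n) e by rewrite sumr_const card_ord mulr_natl.
apply: ler_sum => i _.
have -> : iter i L x = T (i%:R * h) x.
  by rewrite -(semigroup_iter T0 TD) ?(ltW h0) //; apply: eq_iter.
have [->|i0] := eqVneq (i : nat) 0%N; first by rewrite mul0r T0 subrr (nm0 spI).
apply: Tx; first by rewrite mulr_gt0 // ltr0n lt0n.
by rewrite ler_wpM2r ?(ltW h0) // ler_nat ltnW.
Qed.

Lemma iter_one_sub (L : V -> V) n v x : linear L -> v - L v = x ->
  v - iter n L v = \sum_(i < n) iter i L x.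
Proof.
move=> lL vx; rewrite -opprB (iter_sub_sum _ _ lL) -sumrN; apply: eq_bigr => i _.
by rewrite -(mapN (linear_iter i lL)) opprB vx.
Qed.

(* Minus the inverse of the generator, as the limit of the Riemann sums
   [h * \sum_k T (k * h)] along dyadic [h]. *)
Lemma gen_rel_surj x : exists w, gen_rel T w (- x).
Proof.
have ex n : exists g : V -> V, [/\ linear g, (forall x, g x - T (dy n) (g x) = x),
    (forall x, g (x - T (dy n) x) = x) &
    (forall x, dy n * nm (g x) <= K * (r^-1 + dy n) * nm x)].
  exact: one_sub_inverse.
have [g gP] := choice ex.
have lTd n : linear (T (dy n)) := lT (ltW (dy_gt0 n)).
pose c := K * (r^-1 + 1); have c0 : 0 < c.
  by rewrite mulr_gt0 ?(lt_le_trans ltr01 K1) // addr_gt0 // invr_gt0.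
have dy1 n : dy n <= 1 by rewrite invf_le1 ?exprn_gt0 // exprn_ege1 // ler1n.
have gb n y : dy n * nm (g n y) <= c * nm y.
  have [_ _ _ h] := gP n; apply: le_trans (h y) _.
  by rewrite ler_wpM2r ?nm_ge0 // ler_wpM2l // lerD2l.
have itd n j y : iter (2 ^ j) (T (dy (n + j))) y = T (dy n) y.
  by rewrite (semigroup_iter T0 TD) ?(ltW (dy_gt0 _)) // -dyD.
(* [1 - T (dy n)] is [1 - T (dy (n + j))] times the sum of the first [2 ^ j] powers of
   [T (dy (n + j))], which compares the inverses on nested grids. *)
have gD n j y : g n (\sum_(i < 2 ^ j) iter i (T (dy (n + j))) y) = g (n + j)%N y.
  have [_ _ gL _] := gP n; have [_ gR _ _] := gP (n + j)%N.
  by rewrite -(iter_one_sub _ (lTd _) (gR y)) itd gL.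
pose u n := dy n *: g n x.
have near n j e : 0 <= e -> (forall s, 0 < s -> s <= dy n -> nm (T s x - x) <= e) ->
    nm (u (n + j)%N - u n) <= c * e.
  move=> e0 Tx; have [lg _ _ _] := gP n.
  have -> : u (n + j)%N - u n = dy (n + j) *:
      g n (\sum_(i < 2 ^ j) iter i (T (dy (n + j))) x - (2 ^ j)%:R *: x).
    by rewrite (mapB lg) gD (mapZ lg) scalerBr scalerA mulrC -dyD.
  rewrite (nmZ spI) (ger0_norm (ltW (dy_gt0 _))).
  have s := @sum_iter_near (T (dy (n + j))) (dy (n + j)) (2 ^ j) x e (lTd _)
    (fun=> erefl) (dy_gt0 _); rewrite -dyD in s; have {}s := s Tx e0.
  have h2 := le_trans (gb n _) (ler_wpM2l (ltW c0) s).
  rewrite (dyD n j) -mulrA in h2.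
  have p : 0 < (2 ^ j)%:R :> R by rewrite ltr0n expn_gt0.
  by rewrite -(ler_pM2l p); apply: le_trans h2 _; rewrite mulrCA.
have [w wP] : exists w, forall e, 0 < e -> exists N, forall n, (N <= n)%N -> nm (u n - w) <= e.
  apply: Vc => e e0.
  have e2 : 0 < e / 2 / c by rewrite !divr_gt0.
  have [d d0 dP] := TS x e2; have [N /(_ _ (leqnn N)) NP] := dy_small d0.
  have Tx s : 0 < s -> s <= dy N -> nm (T s x - x) <= e / 2 / c.
    by move=> s0 sN; apply: dP => //; apply: le_trans sN NP.
  have cl n : (N <= n)%N -> nm (u n - u N) <= e / 2.
    move=> /subnKC <-; apply: le_trans (near _ _ _ (ltW e2) Tx) _.
    by rewrite mulrC divfK // gt_eqF.
  exists N => m n /cl hm /cl hn; apply: le_trans (nm_tri spI (u N) _ _) _.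
  by rewrite (nmBC spI (u N)); lra.
have dyadic n k e : 0 <= e ->
    (forall s, 0 < s -> s <= k%:R * dy n -> nm (T s x - x) <= e) ->
    nm (T (k%:R * dy n) w - w + (k%:R * dy n) *: x) <= k%:R * dy n * e.
  move=> e0 Tx; set t := k%:R * dy n; have t0 : 0 <= t by rewrite mulr_ge0 ?(ltW (dy_gt0 _)).
  apply/ler_addgt0Pl => f f0.
  have K10 : 0 < K + 1 by rewrite ltr_wpDl.
  have [N /(_ (n + N)%N (leq_addl _ _)) NP] := wP _ (divr_gt0 f0 K10).
  have tE : t = (k * 2 ^ N)%:R * dy (n + N) by rewrite natrM -mulrA -dyD.
  have main : nm (T t (u (n + N)%N) - u (n + N)%N + t *: x) <= t * e.
    have [_ gR _ _] := gP (n + N)%N.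
    have lTt := lT t0; set h := dy (n + N) in tE *; set m := (k * 2 ^ N)%N in tE *.
    have -> : T t (u (n + N)%N) - u (n + N)%N + t *: x =
        - (h *: (\sum_(i < m) iter i (T h) x - m%:R *: x)).
      rewrite -(iter_one_sub m (lTd _) (gR x)) -/h.
      rewrite (semigroup_iter T0 TD) ?(ltW (dy_gt0 _)) // -tE /u -/h (mapZ lTt).
      by apply: (sp_inj spI) => z; rewrite !spE {2}tE; ring.
    rewrite (nmN spI) (nmZ spI) (ger0_norm (ltW (dy_gt0 _))).
    have s := @sum_iter_near (T h) h m x e (lTd _) (fun=> erefl) (dy_gt0 _).
    rewrite -tE in s; apply: le_trans (ler_wpM2l (ltW (dy_gt0 _)) (s Tx e0)) _.
    by rewrite tE mulrCA mulrA.
  have -> : T t w - w + t *: x = (T t (u (n + N)%N) - u (n + N)%N + t *: x) +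
      (- T t (u (n + N)%N - w) + (u (n + N)%N - w)).
    by apply: (sp_inj spI) => z; rewrite (mapB (lT t0)) !spE; ring.
  apply: le_trans (nmD spI _ _) _; rewrite addrC lerD //.
  apply: le_trans (nmD spI _ _) _; rewrite (nmN spI).
  have := TK1 (u (n + N)%N - w) t0; move: NP; rewrite ler_pdivlMr // => NP.
  by lra.
exists w => e e0; have e2 : 0 < e / 2 by rewrite divr_gt0.
have [d d0 dP] := TS x e2.
(* The dyadic time [t'] taken just above [t] is at most [2 * t]: it stays below [d], and the
   oscillation bound [e / 2] gives [t' * (e / 2) <= t * e]. *)
exists (d / 2); first by rewrite divr_gt0.
move=> t tp td; rewrite opprK.
have main : nm (T t w - w + t *: x) <= t * e.
  apply/ler_addgt0Pl => f f0.
  have q0 : 0 < K + nm x + 1 by rewrite ltr_wpDl // addr_ge0 ?nm_ge0.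
  have f1 : 0 < f / (K + nm x + 1) by rewrite divr_gt0.
  have [d' d'0 d'P] := TS w f1.
  have m0 : 0 < Num.min t (Num.min d' (f / (K + nm x + 1))) by rewrite !lt_min tp d'0.
  have [n /(_ _ (leqnn n))] := dy_small m0.
  rewrite !le_min => /and3P[n1 n2 n3].
  have dn0 := dy_gt0 n.
  have /andP[k1 k2] : (Num.trunc (t / dy n))%:R <= t / dy n < (Num.trunc (t / dy n)).+1%:R.
    by apply: truncn_itv; rewrite divr_ge0 // ltW.
  set k := (Num.trunc _).+1 in k2; set t' := k%:R * dy n.
  have t't : t < t' by rewrite -ltr_pdivrMr.
  have t'n : t' <= t + dy n.
    rewrite /t' /k -natr1 mulrDl mul1r lerD2r -ler_pdivlMr //.
  have Tx s : 0 < s -> s <= t' -> nm (T s x - x) <= e / 2.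
    by move=> s0 st; apply: dP => //; lra.
  have := dyadic n k (e / 2) (ltW e2) Tx; rewrite -/t' => D.
  have TT : T t' w - T t w = T t (T (t' - t) w - w).
    rewrite (mapB (lT (ltW tp))) -TD ?(ltW tp) ?subr_ge0 ?(ltW t't) //.
    by rewrite [t + _]addrC subrK.
  have b1 : nm (T t' w - T t w) <= K * (f / (K + nm x + 1)).
    rewrite TT; apply: le_trans (TK1 _ (ltW tp)) _; rewrite ler_wpM2l //.
    by apply: d'P; lra.
  have -> : T t w - w + t *: x = (T t' w - w + t' *: x) +
     (- (T t' w - T t w) + (t - t') *: x).
    by apply: (sp_inj spI) => z; rewrite !spE; ring.
  apply: le_trans (nmD spI _ _) _; apply: le_trans (lerD D (nmD spI _ _)) _.
  rewrite (nmN spI) (nmZ spI).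
  have b2 : `|t - t'| * nm x <= f / (K + nm x + 1) * nm x.
    by rewrite ler_wpM2r ?nm_ge0 // distrC ger0_norm ?subr_ge0 ?(ltW t't) //; lra.
  have b3 : (K + nm x + 1) * (f / (K + nm x + 1)) = f by rewrite mulrC divfK // gt_eqF.
  have b4 : t' * (e / 2) <= t * e.
    have : t' * (e / 2) <= (2 * t) * (e / 2) by rewrite ler_wpM2r ?(ltW e2) //; lra.
    by lra.
  by rewrite mulrDl mulrDl mul1r in b3; lra.
have -> : t^-1 *: (T t w - w) + x = t^-1 *: (T t w - w + t *: x).
  by rewrite [RHS]scalerDr scalerA mulVf ?gt_eqF // scale1r.
rewrite (nmZ spI) ger0_norm ?invr_ge0 ?(ltW tp) // mulrC ler_pdivrMr //.
by rewrite mulrC.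
Qed.

End ExponentiallyStable.

(** * Bounded semigroups: resolvents and the inverse of the generator *)

Section Bounded.
Variables (T : R -> V -> V) (K : R).
Hypothesis K1 : 1 <= K.
Hypothesis lT : forall t, 0 <= t -> linear (T t).
Hypothesis T0 : forall x, T 0 x = x.
Hypothesis TD : forall s t x, 0 <= s -> 0 <= t -> T (s + t) x = T s (T t x).
Hypothesis TS : strong_at0 T.
Hypothesis TK : forall t x, 0 <= t -> nm (T t x) <= K * nm x.

Let K0 : 0 <= K. Proof. exact: le_trans ler01 K1. Qed.

Let linear_rescale c t : 0 <= t -> linear (rescale c T t).
Proof.
by move=> t0 a x y; rewrite /rescale lT // scalerDr !scalerA mulrC.
Qed.

Let rescale0 c x : rescale c T 0 x = x.
Proof. by rewrite /rescale mulr0 expR0 scale1r T0. Qed.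

Let rescaleD c s t x : 0 <= s -> 0 <= t ->
  rescale c T (s + t) x = rescale c T s (rescale c T t x).
Proof.
move=> s0 t0; rewrite /rescale TD // (mapZ (lT s0)) scalerA -expRD.
by rewrite mulrDr.
Qed.

Let strong_rescale c : strong_at0 (rescale c T).
Proof.
move=> x e e0; set w := 2 + nm x.
have w0 : 0 < w by rewrite ltr_wpDr ?nm_ge0.
have ew : 0 < Num.min 1 (e / w) by rewrite lt_min ltr01 divr_gt0.
have [d d0 dP] := TS x (divr_gt0 e0 w0).
have [d' d'0 d'P] := expR_sub1_small c ew.
exists (Num.min d d'); first by rewrite lt_min d0.
move=> h h0; rewrite le_min => /andP[hd hd'].
have {}dP := dP _ h0 hd; have [a _] := d'P _ h0 hd'.
move: a; rewrite le_min => /andP[a1 a2].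
have -> : rescale c T h x - x = expR (c * h) *: (T h x - x) + (expR (c * h) - 1) *: x.
  by apply: (sp_inj spI) => z; rewrite /rescale !spE; ring.
apply: le_trans (nmD spI _ _) _; rewrite !(nmZ spI).
have e1 : `|expR (c * h)| <= 2.
  rewrite -[expR _](subrK 1); apply: le_trans (ler_normD _ _) _.
  by rewrite normr1; lra.
have f1 := ler_pM (normr_ge0 _) (nm_ge0 _) e1 dP.
have f2 := ler_wpM2r (nm_ge0 x) a2.
have : w * (e / w) = e by rewrite mulrC divfK // gt_eqF.
by rewrite {1}/w; lra.
Qed.

Let rescale_bound r t x : 0 <= t -> nm (rescale (- r) T t x) <= K * expR (- r * t) * nm x.
Proof.
move=> t0; rewrite (nmZ spI) (ger0_norm (expR_ge0 _)) mulrAC mulrC ler_wpM2r ?expR_ge0 //.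
exact: TK.
Qed.

(** Damping by [exp (- r s)] gives an exponentially stable semigroup, whose generator is onto; the
    rescaling is then undone. *)
Lemma gen_rel_resolvent r x : 0 < r -> exists w, gen_rel T w (r *: w - x).
Proof.
move=> r0; have [w wP] := gen_rel_surj K1 r0 (@linear_rescale (- r)) (rescale0 _)
  (@rescaleD (- r)) (@strong_rescale _) (@rescale_bound r) x.
exists w; have := gen_rel_rescale r wP; rewrite addrC.
by apply: gen_rel_ext => s y; have := rescaleK (- r) T s y; rewrite opprK.
Qed.

(** The generator of the semigroup damped by [exp (- s)] kills [w], so the damped orbit of [w] is
    constant; yet at time [2 * K] its norm has dropped by the factor [K / exp (2 * K) <= 1 / 2]. *)
Lemma gen_rel_fixed w : gen_rel T w w -> w = 0.
Proof.
move=> g; have := gen_rel_rescale (-1) g; rewrite scaleN1r subrr => {}g.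
have bd t x : 0 <= t -> nm (rescale (-1) T t x) <= K * nm x.
  move=> t0; apply: le_trans (rescale_bound 1 x t0) _.
  rewrite ler_wpM2r ?nm_ge0 // ler_piMr // -[X in _ <= X]expR0 ler_expR.
  by rewrite mulN1r oppr_le0.
have K2 : 0 <= 2 * K by rewrite mulr_ge0.
have := gen_rel_orbit K1 (@linear_rescale (-1)) (rescale0 _) (@rescaleD (-1)) bd K2 g.
rewrite (nm0 spI) mulr0 => h.
have {}h : rescale (-1) T (2 * K) w = w.
  apply/eqP; rewrite -subr_eq0; apply/eqP/(nm_eq0 spI)/le_anti.
  by rewrite h nm_ge0.
have := rescale_bound 1 w K2; rewrite h mulN1r expRN => hw.
have : K / expR (2 * K) <= 1 / 2.
  rewrite ler_pdivrMr ?expR_gt0 //; have := expR_ge1Dx (2 * K); lra.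
move=> hK; apply: (nm_eq0 spI); apply/le_anti; rewrite nm_ge0 andbT.
have := ler_wpM2r (nm_ge0 w) hK; lra.
Qed.

Variables (M beta t0 : R).
Hypotheses (beta1 : 1 < beta) (M0 : 0 <= M) (t01 : 1 < t0).
Hypothesis decay : forall t w a, t0 <= t -> gen_rel T w a ->
  nm (T t w) <= M / (ln t) `^ beta * nm (w - a).

Lemma generator_lower_bound : exists2 c, 0 < c & forall w a, gen_rel T w a -> nm w <= c * nm a.
Proof.
(* Here [ln t] exceeds both [1] and [2 * M], so the decay factor at [t] is at most [1 / 2] and half
   of [nm w] can be absorbed. *)
have m0 := M0; have t1 := t01; set t := expR (2 * M + 1 + t0).
have lt : ln t = 2 * M + 1 + t0 by rewrite expRK.
have l1 : 1 <= ln t by rewrite lt; lra.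
have tt : t0 <= t.
  by apply: le_trans (expR_ge1Dx _); lra.
have t00 : 0 <= t by rewrite expR_ge0.
have eps : M / (ln t) `^ beta <= 1 / 2.
  rewrite ler_pdivrMr ?powR_gt0 ?(lt_le_trans ltr01 l1) //.
  have : ln t <= ln t `^ beta.
    rewrite -[X in X <= _]powRr1 ?(le_trans ler01 l1) //.
    by apply: ler_powR => //; exact: ltW.
  by rewrite {1}lt; lra.
exists (1 + 2 * K * t); first by rewrite ltr_pwDl // !mulr_ge0.
move=> w a g.
have h1 := decay tt g.
have h2 := gen_rel_orbit K1 lT T0 TD TK t00 g.
have h3 : nm w <= nm (T t w) + nm (T t w - w).
  by rewrite -{1}[w](subKr (T t w)) (nmB spI).
have h4 : M / (ln t) `^ beta * nm (w - a) <= 1 / 2 * (nm w + nm a).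
  apply: ler_pM => //; rewrite ?nm_ge0 //; last exact: nmB.
  by rewrite divr_ge0 // powR_ge0.
lra.
Qed.

(** The lower bound gives injectivity; surjectivity comes by perturbation from a small positive
    shift. The lower bound also controls [S = (r - A)^-1] by [4 / 3 * c], uniformly for small [r],
    so for [r = 1 / (4 * c)] the operator [r S] has norm at most [1 / 3], and
    [A^-1 = - S (1 - r S)^-1]. *)
Theorem generator_inverse : exists B b, [/\ linear B, 0 <= b,
  (forall x, nm (B x) <= b * nm x), (forall x, gen_rel T (B x) x) &
  (forall w x, gen_rel T w x -> w = B x)].
Proof.
have lT' h : 0 < h -> linear (T h) by move/ltW/lT.
have [c c0 cP] := generator_lower_bound.
have g0 w w' x : gen_rel T w x -> gen_rel T w' x -> w = w'.
  move=> g g'; have := gen_rel_linear (-1) lT' g' g.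
  rewrite !scaleN1r addNr => /cP; rewrite (nm0 spI) mulr0 => h.
  apply/eqP; rewrite -subr_eq0 addrC; apply/eqP/(nm_eq0 spI)/le_anti.
  by rewrite h nm_ge0.
pose r := 1 / (4 * c); have r0 : 0 < r by rewrite divr_gt0 // mulr_gt0.
have rc : c * r = 1 / 4 by rewrite /r; field; rewrite gt_eqF.
have est w y : gen_rel T w (r *: w - y) -> nm w <= 4 / 3 * c * nm y.
  move=> /cP; move: (nmB spI (r *: w) y); rewrite (nmZ spI) (ger0_norm (ltW r0)) => h1 h2.
  have := ler_wpM2l (ltW c0) h1; rewrite mulrDr mulrA rc => h3.
  by lra.
have [S SP] := choice (fun y => gen_rel_resolvent y r0).
have S_uniq w y : gen_rel T w (r *: w - y) -> w = S y.
  move=> g; have := gen_rel_linear (-1) lT' (SP y) g.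
  have -> : -1 *: (r *: S y - y) + (r *: w - y) = r *: (-1 *: S y + w) - 0.
    by apply: (sp_inj spI) => z; rewrite !spE; ring.
  move=> /est; rewrite (nm0 spI) mulr0 scaleN1r => h.
  apply/eqP; rewrite -subr_eq0 addrC; apply/eqP/(nm_eq0 spI)/le_anti.
  by rewrite h nm_ge0.
have lS : linear S.
  move=> a x y; apply/esym/S_uniq.
  have := gen_rel_linear a lT' (SP x) (SP y); congr gen_rel.
  by apply: (sp_inj spI) => z; rewrite !spE; ring.
have lL : linear (fun x => r *: S x).
  by move=> a x y; rewrite lS scalerDr !scalerA mulrC.
have LK x : nm (r *: S x) <= 1 / 3 * nm x.
  rewrite (nmZ spI) (ger0_norm (ltW r0)).
  apply: le_trans (ler_wpM2l (ltW r0) (est _ _ (SP x))) _.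
  rewrite (_ : r * _ = 4 / 3 * (c * r) * nm x); last ring.
  by rewrite rc; have := nm_ge0 x; lra.
have LKn n x : nm (iter n (fun x => r *: S x) x) <= 1 * (1 / 3) ^+ n * nm x.
  elim: n => [|n IH]; first by rewrite expr0 !mul1r.
  rewrite iterS; apply: le_trans (LK _) _.
  apply: le_trans (ler_wpM2l _ IH) _; first by lra.
  by rewrite exprS; move: ((1 / 3) ^+ n) => p; lra.
have [G [lG GR _ _]] := @neumann _ _ _ spI Vc _ (1 / 3) 1 lL ltac:(lra) ltac:(lra) ler01 LKn.
have BP x : gen_rel T (- S (G x)) x.
  have := gen_rel_linear (-1) lT' (SP (G x)) (SP 0).
  have -> : S 0 = 0 := map0 lS.
  rewrite scaler0 subr0 !addr0 !scaleN1r opprB; congr gen_rel.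
  exact: GR.
exists (fun x => - S (G x)), c; split=> //.
- by move=> a x y; rewrite lG lS scalerN opprD.
- exact: ltW.
- by move=> x; apply: cP.
- by move=> w x g; apply: g0 g (BP x).
Qed.

End Bounded.
End Generator.

(** * Euler approximation of the exponential *)

Lemma exp_sum_le (R : realType) (c : R) n : 0 <= c ->
  \sum_(k < n) c ^+ k / k`!%:R <= expR c.
Proof.
move=> c0; rewrite /expR; have := @is_cvg_series_exp_coeff R c => cv.
have := nondecreasing_cvgn_le _ cv n.
rewrite seriesEnat /= big_mkord; apply.
by apply: nondecreasing_series => k _ _; rewrite divr_ge0 ?exprn_ge0.
Qed.

(** With [v = 1 + c / N] one has [exp (1 - 1 / v) <= v], and the [N]-th power of the left side is
    [exp (c - c^2 / (N + c))]; the tangent of the exponential at [0] finishes. *)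
Lemma expR_euler (R : realType) (c : R) N : 0 <= c -> (0 < N)%N ->
  expR c - (1 + c / N%:R) ^+ N <= expR c * c ^+ 2 / N%:R.
Proof.
move=> c0 N0; have Np : (0 : R) < N%:R by rewrite ltr0n.
set v := 1 + c / N%:R; have v0 : 0 < v by rewrite ltr_pwDl // divr_ge0 // ltW.
have Nc : 0 < N%:R + c by rewrite ltr_pwDl.
set u := 1 - v^-1.
have uv : expR u <= v.
  have := expR_ge1Dx (- u); rewrite expRN.
  have -> : 1 + - u = v^-1 by rewrite /u; ring.
  by rewrite lef_pV2 ?posrE ?expR_gt0.
have h1 : expR (c - c ^+ 2 / (N%:R + c)) <= v ^+ N.
  have -> : c - c ^+ 2 / (N%:R + c) = N%:R * u.
    rewrite /u /v; field; rewrite !gt_eqF //.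
  by rewrite expRM_natl lerXn2r ?nnegrE ?expR_ge0 ?(ltW v0).
rewrite expRD in h1.
have h2 := expR_ge1Dx (- (c ^+ 2 / (N%:R + c))).
have h3 := ler_wpM2l (expR_ge0 c) h2.
have h4 : c ^+ 2 / (N%:R + c) <= c ^+ 2 / N%:R.
  by rewrite ler_wpM2l ?sqr_ge0 // lef_pV2 ?posrE // lerDl.
have := ler_wpM2l (expR_ge0 c) h4.
lra.
Qed.

Section Exponential.
Variables (R : realType) (V : lmodType R) (sp : V -> V -> R).
Hypothesis spI : real_inner sp.
Hypothesis Vc : complete_inner sp.
Local Notation nm := (hnorm sp).
Variables (B : V -> V) (b : R).
Hypotheses (lB : linear B) (b0 : 0 <= b) (Bb : forall x, nm (B x) <= b * nm x).

Lemma euler_binomial k N n x : (N < n)%N ->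
  iter N (euler k B) x = \sum_(j < n) ('C(N, j)%:R * k ^+ j) *: iter j B x.
Proof.
elim: N n => [|N IH] n Nn.
  case: n Nn => // n _; rewrite big_ord_recl /= bin0 expr0 mulr1 scale1r.
  by rewrite big1 ?addr0 // => i _; rewrite bin0n mul0r scale0r.
case: n Nn => // n Nn; rewrite iterS {1}/euler.
rewrite {1}(IH n.+1); last exact: ltnW.
rewrite (IH n) // (map_sum lB) scaler_sumr !big_ord_recl -addrA; congr (_ + _).
  by rewrite !bin0.
rewrite -big_split /=; apply: eq_bigr => i _.
rewrite (mapZ lB) scalerA -scalerDl; congr (_ *: _).
by rewrite /bump /= add1n binS natrD exprS; ring.
Qed.

Lemma bin_le_exp N j (t : R) : 0 <= t -> (0 < N)%N ->
  'C(N, j)%:R * (t / N%:R) ^+ j <= t ^+ j / j`!%:R.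
Proof.
move=> t0 N0; have Np : (0 : R) < N%:R by rewrite ltr0n.
have jp : (0 : R) < j`!%:R by rewrite ltr0n fact_gt0.
rewrite ler_pdivlMr //.
have -> : 'C(N, j)%:R * (t / N%:R) ^+ j * j`!%:R = t ^+ j * ((N ^_ j)%:R / N%:R ^+ j).
  by rewrite expr_div_n -bin_ffact natrM; ring.
rewrite ler_piMr ?exprn_ge0 //.
rewrite ler_pdivrMr ?exprn_gt0 // mul1r -natrX ler_nat.
elim: j {jp} => [|j IH]; first by rewrite ffactn0 expn0.
by rewrite ffactnSr expnSr leq_mul // leq_subr.
Qed.

(** The coefficients of the Euler product do not exceed those of the exponential series, so the
    error is dominated by the scalar one of [expR_euler] at [t * b]. The same comparison shows that
    the partial sums are Cauchy: all late ones are close to one Euler product. *)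
Lemma exp_limit t x : 0 <= t -> exists2 l : V,
  forall e, 0 < e -> exists N, forall n, (N <= n)%N ->
    nm (\sum_(k < n) (t ^+ k / k`!%:R) *: iter k B x - l) <= e &
  forall N, (0 < N)%N ->
    nm (iter N (euler (t / N%:R) B) x - l) <= expR (t * b) * (t * b) ^+ 2 / N%:R * nm x.
Proof.
move=> t0; have tb : 0 <= t * b by rewrite mulr_ge0.
set w := expR (t * b) * (t * b) ^+ 2.
have w0 : 0 <= w by rewrite mulr_ge0 ?expR_ge0 ?sqr_ge0.
pose P n := \sum_(k < n) (t ^+ k / k`!%:R) *: iter k B x.
have nx := nm_ge0 sp x.
have iterb j : nm (iter j B x) <= b ^+ j * nm x.
  elim: j => [|j IH]; first by rewrite expr0 mul1r.
  by rewrite iterS exprS -mulrA; apply: le_trans (Bb _) _; rewrite ler_wpM2l.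
have near N n : (0 < N)%N -> (N < n)%N ->
    nm (iter N (euler (t / N%:R) B) x - P n) <= w / N%:R * nm x.
  move=> N0 Nn; have Np : (0 : R) < N%:R by rewrite ltr0n.
  rewrite (euler_binomial _ _ Nn) (nmBC spI) -sumrB.
  apply: le_trans (nm_sum spI _ _ _) _.
  apply: (@le_trans _ _ (\sum_(j < n) ((t * b) ^+ j / j`!%:R -
      'C(N, j)%:R * (t * b / N%:R) ^+ j) * nm x)).
    apply: ler_sum => j _; rewrite -scalerBl (nmZ spI) ger0_norm ?subr_ge0 ?bin_le_exp //.
    have -> : (t * b) ^+ j / j`!%:R - 'C(N, j)%:R * (t * b / N%:R) ^+ j =
       (t ^+ j / j`!%:R - 'C(N, j)%:R * (t / N%:R) ^+ j) * b ^+ j.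
      by rewrite !expr_div_n !exprMn; ring.
    by rewrite -mulrA ler_wpM2l ?subr_ge0 ?bin_le_exp.
  rewrite -mulr_suml ler_wpM2r // sumrB.
  apply: le_trans (expR_euler tb N0); rewrite lerD ?exp_sum_le // lerN2.
  rewrite le_eqVlt exprDn (big_ord_widen n (fun j => 1 ^+ (N - j) * (t * b / N%:R) ^+ j *+ 'C(N, j))) //.
  rewrite big_mkcond /=; apply/orP; left; apply/eqP; apply: eq_bigr => j _.
  case: ifP => [|]; first by rewrite expr1n mul1r mulr_natl.
  by move/negbT; rewrite -leqNgt => Nj; rewrite bin_small ?mul0r.
have [l lP] : exists l, forall e, 0 < e -> exists N, forall n, (N <= n)%N -> nm (P n - l) <= e.
  apply: Vc => e e0; have e2 : 0 < e / 2 by rewrite divr_gt0.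
  have [N hN] := nat_above (w * nm x / (e / 2)).
  have hN' : w / N.+1%:R * nm x <= e / 2.
    rewrite mulrAC ler_pdivrMr // [X in _ <= X]mulrC -ler_pdivrMr //.
    by apply: le_trans hN _; rewrite ler_nat.
  exists N.+2 => m n hm hn.
  apply: le_trans (nm_tri spI (iter N.+1 (euler (t / N.+1%:R) B) x) _ _) _.
  rewrite (nmBC spI (P m)).
  have a := le_trans (near _ _ (ltn0Sn N) hm) hN'.
  have b' := le_trans (near _ _ (ltn0Sn N) hn) hN'.
  by apply: le_trans (lerD a b') _; lra.
exists l => // N N0; apply/ler_addgt0Pl => e e0.
have [n0 /(_ _ (leq_maxl n0 N.+1)) h] := lP e e0.
apply: le_trans (nm_tri spI (P (maxn n0 N.+1)) _ _) _.
by rewrite addrC lerD // near // leq_maxr.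
Qed.

End Exponential.

Local Open Scope classical_set_scope.
Local Open Scope complex_scope.

(** * Complex Hilbert spaces *)

(* [V] with its scalars restricted to [R]. *)
Definition realified (R : realType) (V : completeNormedModType R[i]) : Type := V.

Section Realified.
Variables (R : realType) (V : completeNormedModType R[i]).
HB.instance Definition _ := GRing.Zmodule.copy (realified V) V.
Let rscale (a : R) (x : realified V) : realified V := (a%:C *: (x : V)).
Fact rscaleA a b x : rscale a (rscale b x) = rscale (a * b) x.
Proof. by rewrite /rscale scalerA -rmorphM. Qed.
Fact rscale1 : left_id 1 rscale.
Proof. by move=> x; rewrite /rscale scale1r. Qed.
Fact rscaleDr : right_distributive rscale +%R.
Proof. by move=> a x y; rewrite /rscale scalerDr. Qed.
Fact rscaleDl x : {morph rscale^~ x : a b / a + b}.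
Proof. by move=> a b; rewrite /rscale rmorphD scalerDl. Qed.
HB.instance Definition _ := GRing.Zmodule_isLmodule.Build R (realified V)
  rscaleA rscale1 rscaleDr rscaleDl.
End Realified.

Section Concrete.
Variables (R : realType) (V : completeNormedModType R[i]) (inner : V -> V -> R[i]).
Hypothesis Vin : is_inner_product inner.

Definition re_inner (x y : realified V) : R := complex.Re (inner x y).
Local Notation nm := (hnorm re_inner).

Lemma normc_real (x : V) : `|x| = (complex.Re `|x|)%:C.
Proof.
have : 0 <= `|x| by [].
by case: `|x| => a c; rewrite lecE /= => /andP[/eqP-> _].
Qed.

Lemma re_inner_sq (x : V) : re_inner x x = (complex.Re `|x|) ^+ 2.
Proof.
by case: Vin => _ _ h; rewrite /re_inner -h normc_real -rmorphXn.
Qed.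

Lemma normE (x : V) : `|x| = (nm x)%:C.
Proof.
rewrite normc_real /hnorm re_inner_sq sqrtr_sqr ger0_norm //.
by have : 0 <= `|x| by []; rewrite normc_real lecR.
Qed.

Lemma re_inner_real : real_inner re_inner.
Proof.
case: Vin => h1 h2 h3; split.
- move=> a x y z; rewrite /re_inner h1.
  by case: (inner x z) (inner y z) => [p q] [p' q'] /=; rewrite mul0r subr0.
- by move=> x y; rewrite /re_inner (h2 x); case: inner.
- by move=> x; rewrite re_inner_sq sqr_ge0.
- move=> x; rewrite re_inner_sq => /eqP; rewrite sqrf_eq0 => /eqP x0.
  by apply/eqP; rewrite -normr_eq0 (normc_real x) x0.
Qed.

(** The order of [R[i]] compares only numbers with equal imaginary parts, so the tolerances in its
    limits are real. *)
Lemma gt0_complex (e : R[i]) : 0 < e -> exists2 r : R, 0 < r & e = r%:C.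
Proof. by case: e => a c; rewrite ltcE /= => /andP[/eqP-> a0]; exists a. Qed.

Lemma norm_ltc (x : V) (e : R) : (`|x| < e%:C) = (nm x < e).
Proof. by rewrite normE ltcR. Qed.

Lemma cvgn_nm (u : nat -> V) l :
  (forall e, 0 < e -> exists N, forall n, (N <= n)%N -> nm (u n - l : V) <= e) ->
  u n @[n --> \oo] --> l.
Proof.
move=> h; apply/cvgrPdist_lt => e /gt0_complex[r r0 ->].
have [N NP] := h (r / 2) ltac:(by rewrite divr_gt0).
exists N => // n /= /NP hn; rewrite distrC norm_ltc.
by apply: le_lt_trans hn _; rewrite ltr_pdivrMr // ltr_pMr // ltr1n.
Qed.

Lemma cvgr_nm (f : R -> V) l : f h @[h --> 0^'+] --> l <->
  forall e, 0 < e -> exists2 d, 0 < d & forall h, 0 < h -> h <= d -> nm (f h - l : V) <= e.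
Proof.
split=> [cf e e0|h].
  have e0' : 0 < e%:C :> R[i] by rewrite ltcR.
  move/cvgrPdist_lt : cf => /(_ _ e0')[d /= d0 dP].
  exists (d / 2); first by rewrite divr_gt0.
  move=> h h0 hd; apply: ltW; rewrite -norm_ltc distrC; apply: dP => //=.
  by rewrite sub0r normrN gtr0_norm // (le_lt_trans hd) // ltr_pdivrMr // ltr_pMr // ltr1n.
apply/cvgrPdist_lt => e /gt0_complex[r r0 ->].
have [d d0 dP] := h (r / 2) ltac:(by rewrite divr_gt0).
exists d => //= s /= sd s0; rewrite distrC norm_ltc.
rewrite sub0r normrN gtr0_norm // in sd.
by apply: le_lt_trans (dP _ s0 (ltW sd)) _; rewrite ltr_pdivrMr // ltr_pMr // ltr1n.
Qed.

Lemma complete_re_inner : complete_inner re_inner.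
Proof.
move=> u uC; have cu : cvg (u n @[n --> \oo]).
  apply/cauchy_cvgP/cauchy_exP => e /gt0_complex[r r0 ->].
  have [N NP] := uC (r / 2) ltac:(by rewrite divr_gt0).
  exists (u N); exists N => // n /= Nn; rewrite -ball_normE /= norm_ltc.
  apply: le_lt_trans (NP _ _ (leqnn N) Nn) _.
  by rewrite ltr_pdivrMr // ltr_pMr // ltr1n.
exists (lim (u n @[n --> \oo])) => e e0.
have e0' : 0 < e%:C :> R[i] by rewrite ltcR.
have /cvgrPdist_lt/(_ _ e0')[N _ NP] := cu.
exists N => n /NP /=; rewrite distrC norm_ltc; exact: ltW.
Qed.

Lemma norm_le (x y : V) (c : R) : (`|x| <= c%:C * `|y|) = (nm x <= c * nm y).
Proof. by rewrite !normE -rmorphM lecR. Qed.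


Variables (T : R -> V -> V) (D : set V) (A : V -> V).
Hypotheses (TC0 : C0_semigroup T) (Tb : bounded_semigroup T) (TG : generator T D A).
Let Tr : R -> realified V -> realified V := T.

Let spI := re_inner_real.

Lemma gen_relE (x y : V) : gen_rel re_inner Tr x y <-> D x /\ A x = y.
Proof.
have [dom lim_A] := TG x; split=> [/cvgr_nm g|[Dx <-]].
  have Dx : D x by apply/dom; apply/cvg_ex; exists y.
  split=> //; apply: (gen_rel_unique spI (T := Tr) (x := x)); last exact/cvgr_nm.
  by apply/cvgr_nm; exact: lim_A.
by apply/cvgr_nm; exact: lim_A.
Qed.

Lemma linear_orbit t : 0 <= t -> linear (Tr t).
Proof.
by move=> t0 a x y; have [/(_ t t0)[h _] _ _ _] := TC0; exact: (h a%:C x y).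
Qed.

Lemma orbit_bound : exists2 K, 1 <= K & forall t x, 0 <= t -> nm (Tr t x) <= K * nm x.
Proof.
have [K KP] := Tb; exists (Num.max K 1); first by rewrite le_max lexx orbT.
move=> t x t0; have := KP t x t0; rewrite norm_le => h; apply: le_trans h _.
by rewrite ler_wpM2r ?nm_ge0 // le_max lexx.
Qed.

Lemma strong_orbit : strong_at0 re_inner Tr.
Proof. by move=> x; have [_ _ _ h] := TC0; apply/cvgr_nm. Qed.

Lemma op_inv_eq (S : V -> V) x y : D x -> S x = y ->
  (forall x', D x' -> S x' = y -> x' = x) -> op_inv D S y = x.
Proof.
move=> Dx Sx uniq; rewrite /op_inv.
have /(xgetPex 0)[] : exists x, [set x | D x /\ S x = y] x by exists x.
exact: uniq.
Qed.

(** [op_inv] selects some preimage, and uniqueness identifies it: two preimages under [1 - A] differ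
    by a vector that [A] fixes, hence by [0]. *)
Lemma res1_eq w a : gen_rel re_inner Tr w a -> res1 D A (w - a : V) = w.
Proof.
move=> g; have /gen_relE[Dw Aw] := g.
have [K K1 TK] := orbit_bound; have [_ T0 TD _] := TC0.
apply: op_inv_eq => //; first by rewrite Aw.
move=> x Dx Ax; have gx : gen_rel re_inner Tr x (A x) by apply/gen_relE.
have := gen_rel_linear spI (-1) (fun h h0 => linear_orbit (ltW h0)) g gx.
rewrite !scaleN1r => gd.
apply/eqP; rewrite -subr_eq0 addrC; apply/eqP.
apply: (gen_rel_fixed spI K1 linear_orbit T0 TD TK); move: gd.
congr gen_rel; have {2}-> : (x : realified V) = w - a + A x by rewrite -Ax subrK.
by rewrite !addrA addNr add0r.
Qed.

Theorem log_decay_bound M beta t0 : 1 < beta -> 0 <= M -> 1 < t0 ->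
  (forall t x, t0 <= t -> `|T t (res1 D A x)| <= (M / (ln t) `^ beta)%:C * `|x|) ->
  exists K : R, forall t x, 0 <= t ->
      `|op_exp (op_inv D A) t (op_inv D A x)| <= K%:C * `|x|.
Proof.
move=> beta1 M0 t01 dec.
have Vc := complete_re_inner.
have [K K1 TK] := orbit_bound; have [_ T0 TD _] := TC0.
have decay t w a : t0 <= t -> gen_rel re_inner Tr w a ->
    nm (Tr t w) <= M / (ln t) `^ beta * nm (w - a).
  by move=> tt g; rewrite -norm_le -{1}(res1_eq g); exact: dec.
have [B [b [lB b0 Bb BP Bu]]] := generator_inverse spI Vc K1 linear_orbit T0 TD strong_orbit TK
  beta1 M0 t01 decay.
have -> : op_inv D A = B.
  apply/funext => x; have /gen_relE[DB AB] := BP x.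
  by apply: op_inv_eq => // x' Dx' Ax'; apply: Bu; apply/gen_relE.
have BA x e : 0 < e -> exists2 d, 0 < d &
    forall h, 0 < h -> h <= d -> nm (gen_err Tr B h x) <= e.
  exact: BP.
(* The factor [b + 1] bounds the norm of [(1 - A) (B x) = B x - x]. *)
have Mb : 0 <= M * (b + 1) by rewrite mulr_ge0 // addr_ge0.
have decayB t x : t0 <= t -> nm (Tr t (B x)) <= M * (b + 1) / (ln t) `^ beta * nm x.
  move=> tt; apply: le_trans (decay _ _ _ tt (BP x)) _.
  rewrite [M * _ / _]mulrAC -[X in _ <= X]mulrA ler_wpM2l ?divr_ge0 ?powR_ge0 //.
  apply: le_trans (nmB spI _ _) _; rewrite mulrDl mul1r lerD2r; exact: Bb.
have [G G0 GP] := euler_orbit_bound spI Vc K1 linear_orbit T0 TD TK b0 Bb BA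
  beta1 Mb t01 decayB.
exists G => t x tp; rewrite norm_le.
have [l lP lE] := exp_limit spI Vc lB b0 Bb (B x) tp.
have -> : op_exp B t (B x) = l.
  by apply: cvg_lim => //; apply: cvgn_nm.
apply/ler_addgt0Pl => e e0.
set w := expR (t * b) * (t * b) ^+ 2 * nm (B x).
have e2 : 0 < e / 2 by rewrite divr_gt0.
have [n0 hn0] := nat_above (w / (e / 2)).
have [N [n0N N0 hN]] := GP t x (e / 2) n0 tp e2.
have Np : 0 < N%:R :> R by rewrite ltr0n.
have hw : w / N%:R <= e / 2.
  rewrite ler_pdivrMr // [X in _ <= X]mulrC -ler_pdivrMr //.
  by apply: le_trans hn0 _; rewrite ler_nat.
have := lE N N0; rewrite (mulrAC _ _ (nm _)) -/w => hl.
rewrite -[l](subKr (iter N (euler (t / N%:R) B) (B x))).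
apply: le_trans (nmB spI _ _) _; move: hN hl.
set u := nm _; set v := nm _ => hN hl.
by lra.
Qed.

End Concrete.

(** From [1 + x <= exp x] one gets [a ln t <= t ^ a]; with [a = 1 / (2 beta)] the square bounds
    [t ^ (1 / beta)] from below by a multiple of the squared logarithm, an exponent above [1]. *)
Lemma poly_rate_le_log_rate (R : realType) (beta t : R) : 0 < beta -> 1 < t ->
  t `^ (- beta^-1) <= 4 * beta ^+ 2 / (ln t) `^ 2.
Proof.
move=> b0 t1; have t0 : 0 < t by rewrite (lt_trans ltr01).
have lt0 : 0 < ln t by rewrite ln_gt0.
set a := (2 * beta)^-1; have a0 : 0 < a by rewrite invr_gt0 mulr_gt0.
have ta : a * ln t <= t `^ a.
  rewrite /powR gt_eqF //; apply: le_trans (expR_ge1Dx _); by rewrite lerDr.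
have l2 : (ln t) `^ 2 = ln t ^+ 2 by rewrite powR_mulrn // ltW.
have t2 : t `^ beta^-1 = (t `^ a) ^+ 2.
  rewrite -powR_mulrn ?powR_ge0 // -powRrM; congr (_ `^ _).
  by rewrite /a; field; rewrite gt_eqF.
rewrite powRN t2 l2 ler_pdivlMr ?exprn_gt0 // mulrC ler_pdivrMr ?exprn_gt0 ?powR_gt0 //.
have -> : ln t = (2 * beta) * (a * ln t) by rewrite mulrA mulfV ?mul1r // gt_eqF // mulr_gt0.
rewrite exprMn (_ : (2 * beta) ^+ 2 = 4 * beta ^+ 2); last ring.
have c0 : 0 <= 4 * beta ^+ 2 by rewrite mulr_ge0 // sqr_ge0.
have al : 0 <= a * ln t by rewrite mulr_ge0 // ltW.
by rewrite ler_wpM2l // ler_sqr ?nnegrE ?powR_ge0.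
Qed.

Theorem theorem2p13 (R : realType) (V : completeNormedModType R[i])
    (inner : V -> V -> R[i]) (T : R -> V -> V) (D : set V) (A : V -> V) :
  is_inner_product inner ->
  C0_semigroup T ->
  bounded_semigroup T ->
  generator T D A ->
  (* main statement: logarithmic decay with beta > 1 *)
  ((exists beta M t0 : R, [/\ 1 < beta, 0 < M, 1 < t0 &
      forall t x, t0 <= t ->
        `|T t (res1 D A x)| <= (M / (ln t) `^ beta)%:C * `|x|]) ->
    exists K : R, forall t x, 0 <= t ->
      `|op_exp (op_inv D A) t (op_inv D A x)| <= K%:C * `|x|) /\
  (* in particular: polynomial stability with any parameter beta > 0 *)
  ((exists beta : R, 0 < beta /\ polynomially_stable T D A beta) ->
    exists K : R, forall t x, 0 <= t ->
      `|op_exp (op_inv D A) t (op_inv D A x)| <= K%:C * `|x|).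
Proof.
move=> Vin TC0 Tb TG; split=> [[beta [M [t0 [b1 M0 t01 dec]]]]|[beta [b0 [_ [M [t0 [M0 t00 dec]]]]]]].
  exact: (log_decay_bound Vin TC0 Tb TG b1 (ltW M0) t01 dec).
(* Polynomial stability only provides a positive [t0]; [t0 + 1] meets the requirement of a threshold
   above [1]. *)
apply: (log_decay_bound Vin TC0 Tb TG (beta := 2) (M := M * (4 * beta ^+ 2)) (t0 := t0 + 1)) => //.
- by rewrite ltr1n.
- by rewrite !mulr_ge0 ?sqr_ge0 // ltW.
- by rewrite ltrDr.
move=> t x tt; apply: le_trans (dec t x _) _; first by apply: le_trans tt; rewrite lerDl.
rewrite ler_wpM2r // lecR -mulrA ler_pM2l //.
by apply: poly_rate_le_log_rate => //; apply: lt_le_trans tt; rewrite ltrDr.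
Qed.
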